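(* Let four functions $\nu_1(u,v), \nu_2(u,v), \gamma_1(u,v), \gamma_2(u,v)$ with $\nu_1-\nu_2>0$ be defined in a neighborhood $\mathcal D\subset\mathbb R^2$ of $(u_0,v_0)$ and satisfy the conditions 1) $\gamma_1\,(\nu_1)_v>0$, $\ \gamma_2\,(\nu_2)_u>0$; 2.1) $\displaystyle \left(\ln\frac{(\nu_1)_v}{\gamma_1}\right)_u=\frac{(\nu_1)_u}{\nu_1-\nu_2}$, $\quad \displaystyle\left(\ln\frac{(\nu_2)_u}{\gamma_2}\right)_v=-\frac{(\nu_2)_v}{\nu_1-\nu_2}$; 2.2) $\displaystyle \frac{\nu_1-\nu_2}{2}\left(\frac{(\gamma_2^2)_u}{(\nu_2)_u}-\frac{(\gamma_1^2)_v}{(\nu_1)_v}\right)+\gamma_1^2+\gamma_2^2=\nu_1\nu_2$. Let $z_0X_0Y_0l_0$ be an initial positively oriented orthonormal frame (a point $z_0\in\mathbb R^3_1$ and a positively oriented orthonormal triple $X_0,Y_0,l_0$ with $X_0^2=Y_0^2=1$, $l_0^2=-1$). Then there exists a unique up to a motion strongly regular space-like surface $S: z=z(u,v)$, $(u,v)\in\mathcal D_0$, where $(u_0,v_0)\in\mathcal D_0\subset\mathcal D$, with prescribed invariants $\nu_1,\nu_2,\gamma_1,\gamma_2$ such that $$z(u_0,v_0)=z_0,\quad X(u_0,v_0)=X_0,\quad Y(u_0,v_0)=Y_0,\quad l(u_0,v_0)=l_0.$$ Furthermore, $(u,v)$ are principal parameters for the surface $S$.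
   Context: $\mathbb R^3_1$ is three-dimensional oriented Minkowski space with flat metric $\langle\,,\rangle$ of signature $(2,1)$; products of vectors below are with respect to this metric. All functions are assumed smooth. Subscripts $u,v$ on functions denote partial derivatives. A surface $z=z(u,v)$ in $\mathbb R^3_1$ is space-like if its induced metric is positive definite; its unit normal field $l$ satisfies $l^2=-1$. Put $E=z_u^2$, $F=z_uz_v$, $G=z_v^2$, $L=l z_{uu}$, $M=l z_{uv}$, $N=l z_{vv}$. Surfaces are assumed free of umbilical points, and $(u,v)$ are called principal parameters if $F=M=0$. With respect to principal parameters the principal curvatures and the principal geodesic curvatures are $$\nu_1=\frac LE,\quad \nu_2=\frac NG,\quad \gamma_1=-\frac{E_v}{2E\sqrt G},\quad \gamma_2=\frac{G_u}{2G\sqrt E};$$ these four functions are called the invariants of the surface. The moving frame is $X=z_u/\sqrt E$, $Y=z_v/\sqrt G$, $l$, always assumed positively oriented. It is assumed throughout that $\nu_1-\nu_2>0$. The surface is called strongly regular if $(\nu_1-\nu_2)\gamma_1\gamma_2\neq0$ at every point of its domain. *)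

(* Defs.v *)
From Stdlib Require Import Reals.
From Coquelicot Require Import Coquelicot.
Open Scope R_scope.

Definition du (f : R -> R -> R) : R -> R -> R :=
  fun u v => Derive (fun t => f t v) u.
Definition dv (f : R -> R -> R) : R -> R -> R :=
  fun u v => Derive (fun t => f u t) v.

(** Functions are total on R * R, but only their restriction to the open set [D]
    matters.  [ex_diff_n f n u v] says that the partial derivatives of [f] of order
    at most [n] exist and are continuous at (u, v). *)
Definition smooth_on (D : R * R -> Prop) (f : R -> R -> R) : Prop :=
  forall u v : R, D (u, v) -> forall n : nat, ex_diff_n f n u v.

Definition connected_set (D : R * R -> Prop) : Prop :=
  forall U V : R * R -> Prop,
    open U -> open V ->
    (forall p, D p -> U p \/ V p) ->
    (exists p, D p /\ U p) -> (exists p, D p /\ V p) ->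
    exists p, D p /\ U p /\ V p.

(** Minkowski space is modelled as R^3 with the metric diag(1, 1, -1) and the
    orientation of the standard basis. *)

Definition vec : Type := (R * R * R)%type.
Definition crd1 (w : vec) : R := fst (fst w).
Definition crd2 (w : vec) : R := snd (fst w).
Definition crd3 (w : vec) : R := snd w.

Definition mink (a b : vec) : R :=
  crd1 a * crd1 b + crd2 a * crd2 b - crd3 a * crd3 b.

Definition det3 (a b c : vec) : R :=
  crd1 a * (crd2 b * crd3 c - crd3 b * crd2 c)
  - crd2 a * (crd1 b * crd3 c - crd3 b * crd1 c)
  + crd3 a * (crd1 b * crd2 c - crd2 b * crd1 c).

Definition positive_orthonormal_frame (X Y l : vec) : Prop :=
  mink X X = 1 /\ mink Y Y = 1 /\ mink l l = -1 /\
  mink X Y = 0 /\ mink X l = 0 /\ mink Y l = 0 /\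
  0 < det3 X Y l.

(** Motions are the orientation-preserving affine isometries; they may reverse the
    time direction, since positively oriented frames (X, Y, l) may have [l] in either
    half of the light cone. *)
Definition is_motion (T : vec -> vec) : Prop :=
  exists (A : vec -> vec) (b : vec),
    is_linear A /\
    (forall x y : vec, mink (A x) (A y) = mink x y) /\
    (forall x y w : vec, det3 (A x) (A y) (A w) = det3 x y w) /\
    (forall x : vec, T x = plus (A x) b).

Definition vdu (z : R -> R -> vec) : R -> R -> vec := fun u v =>
  (du (fun s t => crd1 (z s t)) u v,
   du (fun s t => crd2 (z s t)) u v,
   du (fun s t => crd3 (z s t)) u v).
Definition vdv (z : R -> R -> vec) : R -> R -> vec := fun u v =>
  (dv (fun s t => crd1 (z s t)) u v,
   dv (fun s t => crd2 (z s t)) u v,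
   dv (fun s t => crd3 (z s t)) u v).

Definition vsmooth_on (D : R * R -> Prop) (z : R -> R -> vec) : Prop :=
  smooth_on D (fun u v => crd1 (z u v)) /\
  smooth_on D (fun u v => crd2 (z u v)) /\
  smooth_on D (fun u v => crd3 (z u v)).

Definition coefE (z : R -> R -> vec) (u v : R) : R := mink (vdu z u v) (vdu z u v).
Definition coefF (z : R -> R -> vec) (u v : R) : R := mink (vdu z u v) (vdv z u v).
Definition coefG (z : R -> R -> vec) (u v : R) : R := mink (vdv z u v) (vdv z u v).
Definition coefL (z l : R -> R -> vec) (u v : R) : R :=
  mink (l u v) (vdu (vdu z) u v).
Definition coefM (z l : R -> R -> vec) (u v : R) : R :=
  mink (l u v) (vdv (vdu z) u v).
Definition coefN (z l : R -> R -> vec) (u v : R) : R :=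
  mink (l u v) (vdv (vdv z) u v).

Definition frameX (z : R -> R -> vec) (u v : R) : vec :=
  scal (/ sqrt (coefE z u v)) (vdu z u v).
Definition frameY (z : R -> R -> vec) (u v : R) : vec :=
  scal (/ sqrt (coefG z u v)) (vdv z u v).

Definition space_like (D : R * R -> Prop) (z : R -> R -> vec) : Prop :=
  forall u v : R, D (u, v) ->
  forall a b : R, (a <> 0 \/ b <> 0) ->
    0 < coefE z u v * a ^ 2 + 2 * coefF z u v * (a * b) + coefG z u v * b ^ 2.

(** The orientation condition selects one of the two unit normals, so that [l] is
    determined by [z] on [D]. *)
Definition unit_normal (D : R * R -> Prop) (z l : R -> R -> vec) : Prop :=
  vsmooth_on D l /\
  forall u v : R, D (u, v) ->
    mink (l u v) (l u v) = -1 /\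
    mink (l u v) (vdu z u v) = 0 /\
    mink (l u v) (vdv z u v) = 0 /\
    0 < det3 (frameX z u v) (frameY z u v) (l u v).

Definition umbilical_point (z l : R -> R -> vec) (u v : R) : Prop :=
  exists k : R,
    coefL z l u v = k * coefE z u v /\
    coefM z l u v = k * coefF z u v /\
    coefN z l u v = k * coefG z u v.

Definition space_like_surface (D : R * R -> Prop) (z l : R -> R -> vec) : Prop :=
  vsmooth_on D z /\ space_like D z /\ unit_normal D z l /\
  (forall u v : R, D (u, v) -> ~ umbilical_point z l u v).

Definition principal_parameters (D : R * R -> Prop) (z l : R -> R -> vec) : Prop :=
  forall u v : R, D (u, v) -> coefF z u v = 0 /\ coefM z l u v = 0.

(** These formulas give the principal curvatures and the principal geodesic curvatures
    only when (u, v) are principal parameters. *)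
Definition inv_nu1 (z l : R -> R -> vec) (u v : R) : R :=
  coefL z l u v / coefE z u v.
Definition inv_nu2 (z l : R -> R -> vec) (u v : R) : R :=
  coefN z l u v / coefG z u v.
Definition inv_gamma1 (z : R -> R -> vec) (u v : R) : R :=
  - (dv (coefE z) u v / (2 * coefE z u v * sqrt (coefG z u v))).
Definition inv_gamma2 (z : R -> R -> vec) (u v : R) : R :=
  du (coefG z) u v / (2 * coefG z u v * sqrt (coefE z u v)).

Definition strongly_regular (D : R * R -> Prop) (z l : R -> R -> vec) : Prop :=
  forall u v : R, D (u, v) ->
    (inv_nu1 z l u v - inv_nu2 z l u v) * inv_gamma1 z u v * inv_gamma2 z u v <> 0.

Definition has_invariants (D : R * R -> Prop) (z l : R -> R -> vec)
    (nu1 nu2 gam1 gam2 : R -> R -> R) : Prop :=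
  forall u v : R, D (u, v) ->
    inv_nu1 z l u v = nu1 u v /\ inv_nu2 z l u v = nu2 u v /\
    inv_gamma1 z u v = gam1 u v /\ inv_gamma2 z u v = gam2 u v.

Definition initial_frame (z l : R -> R -> vec) (u0 v0 : R)
    (z0 X0 Y0 l0 : vec) : Prop :=
  z u0 v0 = z0 /\ frameX z u0 v0 = X0 /\ frameY z u0 v0 = Y0 /\ l u0 v0 = l0.

(* Main.v *)
Require Import Defs.
From Stdlib Require Import Reals Lra Lia List ClassicalEpsilon.
From Coquelicot Require Import Coquelicot.
Open Scope R_scope.

(** The four invariants determine the speeds of the parameter lines: the Codazzi
    equations force sqrt E = p and sqrt G = q, where
      p = (nu2)_u / (gam2 (nu1 - nu2)),  q = (nu1)_v / (gam1 (nu1 - nu2)).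
    A surface with these speeds is an integral of the linear system
      z_u = p X,  X_u = gam1 p Y - nu1 p l,  Y_u = - gam1 p X,  l_u = - nu1 p X,
      z_v = q Y,  X_v = gam2 q Y,  Y_v = - gam2 q X - nu2 q l,  l_v = - nu2 q Y.
    The logarithmic conditions [cond21] say that p_v = - gam1 p q and q_u = gam2 p q, the
    condition [cond22] is the Gauss equation, and together they are the integrability condition of the system
    ([invariants_integrable]).

    Existence.  A linear system A_u = P A, A_v = Q A with P_v + P Q = Q_u + Q P is
    solved on a small square ([pfaffian_exists]).  With K = P_v + P Q, the integral form
    of A_uv = K A, with data given by the system on the two axes through the initial
    point, has a continuous solution, obtained as the fixed point of a contraction
    ([goursat]).  It is differentiable by the fundamental theorem of calculus, and the
    defects W = A_u - P A and Z = A_v - Q A satisfy W_v = - P Z and Z_u = - Q W with zero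
    data on the axes, so they vanish ([characteristic_zero]).  Smoothness follows by
    differentiating the equations repeatedly ([pfaffian_smooth]).

    The coefficient matrices of the frame equations are skew for diag(1, 1, -1), so the
    pairing x x' + y y' - l l' of two solutions has zero derivatives and is constant on
    connected open sets ([frame_pairing_const]).  Applied to the coordinate columns of one
    frame, this shows that an initially orthonormal frame stays orthonormal
    ([frame_orthonormal]); the prescribed invariants are then read off from the frame
    equations ([framed_surface_geometry]).

    Uniqueness.  On a surface in principal parameters, Rodrigues' formulas
    l_u = - nu1 z_u, l_v = - nu2 z_v and the equality of the mixed derivatives of l give
    the Codazzi equations, hence the speeds p and q ([surface_speeds]), and its frame
    satisfies the system above ([surface_framed]).  The pairing of the columns of two such
    frames is constant, so the frames, and then the surfaces, differ by a motion
    ([framed_surface_unique]). *)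

(** * Fixed points of halving operators *)

(** A contraction principle for the distance of uniform convergence.  The operator needs
    to halve distances only inside a class [C] of functions closed under uniform limits;
    the members of [C] need not be bounded, only the first step has to be. *)
Lemma halving_fixed_point {T : Type} (C : (T -> R) -> Prop)
  (Phi : (T -> R) -> T -> R) (f0 : T -> R) (b : R)
  (C_closed : forall f, (forall eps, 0 < eps ->
     exists g, C g /\ forall x, Rabs (f x - g x) <= eps) -> C f)
  (C_Phi : forall f, C f -> C (Phi f))
  (Phi_halves : forall f g c, C f -> C g ->
     (forall x, Rabs (f x - g x) <= c) ->
     forall x, Rabs (Phi f x - Phi g x) <= c / 2)
  (C_f0 : C f0) (f0_b : forall x, Rabs (Phi f0 x - f0 x) <= b) :
  exists f, C f /\ (forall x, Phi f x = f x) /\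
    (forall x, Rabs (f x - f0 x) <= 2 * b).
Proof.
  pose (F := fun n => Nat.iter n Phi f0).
  assert (HC : forall n, C (F n)).
  { intros n; induction n as [|n IH]; [exact C_f0|]. apply C_Phi, IH. }
  assert (Hstep : forall n x, Rabs (F (S n) x - F n x) <= b / 2 ^ n).
  { intros n; induction n as [|n IH]; intros x.
    - change (F 1%nat x) with (Phi f0 x). change (F 0%nat x) with (f0 x).
      simpl; rewrite Rdiv_1_r; apply f0_b.
    - replace (b / 2 ^ S n) with (b / 2 ^ n / 2)
        by (simpl; field; apply pow_nonzero; lra).
      apply (Phi_halves (F (S n)) (F n)); auto. }
  assert (Hfar : forall n k x, Rabs (F (n + k)%nat x - F n x)
                               <= 2 * b / 2 ^ n - 2 * b / 2 ^ (n + k)).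
  { intros n k x; induction k as [|k IH].
    - rewrite Nat.add_0_r, !Rminus_diag, Rabs_R0; lra.
    - rewrite Nat.add_succ_r.
      replace (F (S (n + k)) x - F n x)
        with ((F (S (n + k)) x - F (n + k)%nat x) + (F (n + k)%nat x - F n x))
        by ring.
      eapply Rle_trans; [apply Rabs_triang|].
      specialize (Hstep (n + k)%nat x).
      replace (2 * b / 2 ^ S (n + k)) with (b / 2 ^ (n + k))
        by (simpl; field; apply pow_nonzero; lra).
      replace (2 * b / 2 ^ (n + k)) with (b / 2 ^ (n + k) + b / 2 ^ (n + k)) in IH
        by (field; apply pow_nonzero; lra).
      lra. }
  assert (Hb : forall x : T, 0 <= b).
  { intros x; eapply Rle_trans; [apply Rabs_pos|apply (f0_b x)]. }
  assert (Hfar' : forall n m x, (n <= m)%nat ->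
                  Rabs (F m x - F n x) <= 2 * b / 2 ^ n).
  { intros n m x Hnm. replace m with (n + (m - n))%nat by lia.
    eapply Rle_trans; [apply Hfar|].
    assert (0 <= 2 * b / 2 ^ (n + (m - n))).
    { apply Rdiv_le_0_compat; [specialize (Hb x); lra|apply pow_lt; lra]. }
    lra. }
  assert (Hsmall : forall eps, 0 < eps -> exists n, 2 * b / 2 ^ n < eps).
  { intros eps He.
    destruct (Rlt_dec 0 b) as [Hb0|Hb0].
    - assert (Hq : Rabs (/ 2) < 1) by (rewrite Rabs_pos_eq; lra).
      destruct (pow_lt_1_zero (/ 2) Hq (eps / (2 * b))) as [n Hn].
      { apply Rdiv_lt_0_compat; lra. }
      exists n. specialize (Hn n (Nat.le_refl n)).
      rewrite pow_inv in Hn.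
      rewrite Rabs_pos_eq in Hn
        by (left; apply Rinv_0_lt_compat, pow_lt; lra).
      unfold Rdiv. apply (Rmult_lt_compat_l (2 * b)) in Hn; [|lra].
      replace (2 * b * (eps / (2 * b))) with eps in Hn by (field; lra). lra.
    - exists 0%nat; simpl; lra. }
  assert (Hcv : forall x, ex_finite_lim_seq (fun n => F n x)).
  { intros x; apply ex_lim_seq_cauchy_corr. intros eps.
    destruct (Hsmall (eps / 2)) as [N HN]; [apply is_pos_div_2|].
    exists N; intros n m Hn Hm.
    pose proof (Hfar' N n x Hn). pose proof (Hfar' N m x Hm).
    replace (F n x - F m x) with ((F n x - F N x) + - (F m x - F N x)) by ring.
    eapply Rle_lt_trans; [apply Rabs_triang|]. rewrite Rabs_Ropp. lra. }
  pose (f := fun x => real (Lim_seq (fun n => F n x))).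
  assert (Hf : forall n x, Rabs (f x - F n x) <= 2 * b / 2 ^ n).
  { intros n x.
    pose proof (Lim_seq_correct' _ (Hcv x)) as Hl. fold (f x) in Hl.
    assert (Hl' : is_lim_seq (fun k => Rabs (F k x - F n x)) (Rabs (f x - F n x))).
    { apply (is_lim_seq_abs _ (f x - F n x)).
      apply (is_lim_seq_minus' (fun k => F k x) (fun _ => F n x)); [exact Hl|].
      apply is_lim_seq_const. }
    refine (is_lim_seq_le_loc _ (fun _ => 2 * b / 2 ^ n) _ _ _ Hl'
              (is_lim_seq_const _)).
    exists n; intros m Hm; apply Hfar', Hm. }
  assert (Cf : C f).
  { apply C_closed; intros eps He. destruct (Hsmall eps He) as [n Hn].
    exists (F n); split; [apply HC|]. intros x. specialize (Hf n x); lra. }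
  exists f; split; [exact Cf|]; split.
  - intros x. apply cond_eq; intros eps He.
    destruct (Hsmall (eps / 2)) as [n Hn]; [lra|].
    replace (Phi f x - f x)
      with ((Phi f x - Phi (F n) x) + - (f x - F (S n) x))
      by (change (F (S n) x) with (Phi (F n) x); ring).
    eapply Rle_lt_trans; [apply Rabs_triang|]. rewrite Rabs_Ropp.
    pose proof (Phi_halves f (F n) (2 * b / 2 ^ n) Cf (HC n) (Hf n) x).
    pose proof (Hf (S n) x) as H1.
    replace (2 * b / 2 ^ S n) with (2 * b / 2 ^ n / 2) in H1
      by (simpl; field; apply pow_nonzero; lra). lra.
  - intros x. pose proof (Hf 0%nat x) as H. simpl in H.
    rewrite Rdiv_1_r in H. exact H.
Qed.

(** * Integrals of functions of two variables *)

(** Continuity on the whole plane. *)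
Definition cont2 (f : R -> R -> R) : Prop := forall u v, continuity_2d_pt f u v.

Lemma cont2_slice1 (f : R -> R -> R) (v x : R) :
  cont2 f -> continuous (fun u => f u v) x.
Proof.
  intros Hf. apply continuity_pt_filterlim, continuity_pt_locally.
  intros eps. destruct (Hf x v eps) as [d Hd].
  exists d; intros y Hy. apply Hd; [exact Hy|].
  rewrite Rminus_diag, Rabs_R0; apply cond_pos.
Qed.

Lemma cont2_swap (f : R -> R -> R) : cont2 f -> cont2 (fun u v => f v u).
Proof.
  intros Hf u v eps. destruct (Hf v u eps) as [d Hd].
  exists d; intros; apply Hd; assumption.
Qed.

Lemma cont2_slice2 (f : R -> R -> R) (u x : R) :
  cont2 f -> continuous (fun v => f u v) x.
Proof. intros Hf. apply (cont2_slice1 (fun a b => f b a)), cont2_swap, Hf. Qed.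

Lemma cont2_comp (f g k : R -> R -> R) :
  cont2 f -> cont2 g -> cont2 k -> cont2 (fun u v => f (g u v) (k u v)).
Proof.
  intros Hf Hg Hk u v eps.
  destruct (Hf (g u v) (k u v) eps) as [d Hd].
  destruct (Hg u v d) as [d1 H1]. destruct (Hk u v d) as [d2 H2].
  exists (mkposreal _ (Rmin_stable_in_posreal d1 d2)); simpl.
  intros x y Hx Hy. apply Hd.
  - apply H1; (eapply Rlt_le_trans; [eassumption|apply Rmin_l]).
  - apply H2; (eapply Rlt_le_trans; [eassumption|apply Rmin_r]).
Qed.

Lemma cont2_of_1d (f : R -> R) :
  (forall x, continuous f x) -> cont2 (fun u _ => f u).
Proof.
  intros Hf u v. apply (continuity_1d_2d_pt_comp f (fun a _ => a)).
  - apply continuity_pt_filterlim, Hf.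
  - apply continuity_2d_pt_id1.
Qed.

(** Uniform limits preserve continuity. *)
Lemma cont2_uniform_limit (f : R -> R -> R) :
  (forall eps, 0 < eps ->
     exists g, cont2 g /\ forall u v, Rabs (f u v - g u v) <= eps) -> cont2 f.
Proof.
  intros H u v eps. destruct (H (eps / 4)) as [g [Hg Hfg]].
  { pose proof (cond_pos eps); lra. }
  assert (He : 0 < eps / 4) by (pose proof (cond_pos eps); lra).
  destruct (Hg u v (mkposreal _ He)) as [d Hd]; simpl in Hd.
  exists d; intros x y Hx Hy. specialize (Hd x y Hx Hy).
  pose proof (Hfg x y) as H1; pose proof (Hfg u v) as H2.
  replace (f x y - f u v)
    with ((f x y - g x y) + ((g x y - g u v) + - (f u v - g u v))) by ring.
  eapply Rle_lt_trans; [apply Rabs_triang|].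
  pose proof (Rabs_triang (g x y - g u v) (- (f u v - g u v))) as H3.
  rewrite Rabs_Ropp in H3. lra.
Qed.

Lemma ex_RInt_cont (f : R -> R) (a b : R) :
  (forall x, continuous f x) -> ex_RInt f a b.
Proof. intros Hf. apply (@ex_RInt_continuous R_CompleteNormedModule); auto. Qed.

Lemma RInt_dist_le (f g : R -> R) (a b c : R) :
  (forall x, continuous f x) -> (forall x, continuous g x) ->
  (forall x, Rmin a b <= x <= Rmax a b -> Rabs (f x - g x) <= c) ->
  Rabs (RInt f a b - RInt g a b) <= Rabs (b - a) * c.
Proof.
  intros Hf Hg.
  assert (Hle : forall a b, a <= b ->
    (forall x, a <= x <= b -> Rabs (f x - g x) <= c) ->
    Rabs (RInt f a b - RInt g a b) <= (b - a) * c).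
  { intros a' b' Hab H.
    pose proof (RInt_minus f g a' b' (ex_RInt_cont f a' b' Hf)
                  (ex_RInt_cont g a' b' Hg)) as E.
    change (minus (RInt f a' b') (RInt g a' b'))
      with (RInt f a' b' - RInt g a' b') in E.
    rewrite <- E. apply abs_RInt_le_const; [exact Hab| |exact H].
    apply (@ex_RInt_minus R_NormedModule); apply ex_RInt_cont; assumption. }
  intros H. destruct (Rle_dec a b) as [Hab|Hab].
  - rewrite (Rabs_pos_eq (b - a)) by lra. apply Hle; [exact Hab|].
    rewrite Rmin_left, Rmax_right in H by exact Hab. exact H.
  - rewrite <- (opp_RInt_swap f b a), <- (opp_RInt_swap g b a)
      by (apply ex_RInt_cont; assumption).
    change (opp (RInt f b a)) with (- RInt f b a).
    change (opp (RInt g b a)) with (- RInt g b a).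
    replace (- RInt f b a - - RInt g b a)
      with (- (RInt f b a - RInt g b a)) by ring.
    rewrite Rabs_Ropp, (Rabs_left (b - a)) by lra.
    replace (- (b - a)) with (a - b) by ring.
    apply Hle; [lra|].
    rewrite Rmin_right, Rmax_left in H by lra. exact H.
Qed.

Lemma RInt_abs_le (f : R -> R) (a b c : R) :
  (forall x, continuous f x) ->
  (forall x, Rmin a b <= x <= Rmax a b -> Rabs (f x) <= c) ->
  Rabs (RInt f a b) <= Rabs (b - a) * c.
Proof.
  intros Hf H.
  pose proof (RInt_dist_le f (fun _ => 0) a b c Hf
                (fun x => continuous_const 0 x)) as H1.
  rewrite RInt_const in H1. change (scal (b - a) 0) with ((b - a) * 0) in H1.
  rewrite Rmult_0_r, Rminus_0_r in H1. apply H1.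
  intros x Hx; rewrite Rminus_0_r; auto.
Qed.

Lemma is_derive_RInt_cont (f : R -> R) (a x : R) :
  (forall y, continuous f y) -> is_derive (fun y => RInt f a y) x (f x).
Proof.
  intros Hf. apply (is_derive_RInt f (fun y => RInt f a y) a x); [|apply Hf].
  apply filter_forall; intros y. apply (@RInt_correct R_CompleteNormedModule).
  apply ex_RInt_cont, Hf.
Qed.

(** An integral is jointly continuous in a parameter and in its upper bound. *)
Lemma cont2_RInt (h : R -> R -> R) (a : R) :
  cont2 h -> cont2 (fun u v => RInt (fun t => h u t) a v).
Proof.
  intros Hh u v eps.
  (* The interval of radius B about a contains every upper bound at distance < 1 of v. *)
  pose (B := Rabs (v - a) + 1).
  assert (HB : 0 < B) by (unfold B; pose proof (Rabs_pos (v - a)); lra).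
  pose proof (cond_pos eps) as He0.
  assert (He : 0 < eps / (2 * B)) by (apply Rdiv_lt_0_compat; lra).
  destruct (uniform_continuity_2d h (u - 1) (u + 1) (a - B) (a + B)
              (fun x y _ _ => Hh x y) (mkposreal _ He)) as [d1 H1].
  simpl in H1.
  assert (Hc : continuous (fun y => RInt (fun t => h u t) a y) v).
  { apply (@ex_derive_continuous _ R_NormedModule). eexists.
    apply is_derive_RInt_cont. intros y; apply cont2_slice2, Hh. }
  apply continuity_pt_filterlim,
    continuity_pt_locally with (eps := mkposreal _ (is_pos_div_2 eps)) in Hc.
  destruct Hc as [d2 H2]; simpl in H2.
  assert (Hd : 0 < Rmin 1 (Rmin d1 d2)).
  { apply Rmin_glb_lt; [lra|]. apply Rmin_glb_lt; apply cond_pos. }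
  exists (mkposreal _ Hd); simpl. intros x y Hx Hy.
  assert (Hx1 : Rabs (x - u) < 1)
    by (eapply Rlt_le_trans; [exact Hx|apply Rmin_l]).
  assert (Hy1 : Rabs (y - v) < 1)
    by (eapply Rlt_le_trans; [exact Hy|apply Rmin_l]).
  assert (Hxd : Rabs (x - u) < d1).
  { eapply Rlt_le_trans; [exact Hx|].
    eapply Rle_trans; [apply Rmin_r|apply Rmin_l]. }
  assert (Hyd : Rabs (y - v) < d2).
  { eapply Rlt_le_trans; [exact Hy|].
    eapply Rle_trans; [apply Rmin_r|apply Rmin_r]. }
  specialize (H2 y Hyd).
  replace (RInt (fun t => h x t) a y - RInt (fun t => h u t) a v)
    with ((RInt (fun t => h x t) a y - RInt (fun t => h u t) a y) +
          (RInt (fun t => h u t) a y - RInt (fun t => h u t) a v)) by ring.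
  eapply Rle_lt_trans; [apply Rabs_triang|].
  assert (HyB : Rabs (y - a) <= B).
  { replace (y - a) with ((y - v) + (v - a)) by ring.
    eapply Rle_trans; [apply Rabs_triang|]. unfold B; lra. }
  assert (H3 : Rabs (RInt (fun t => h x t) a y - RInt (fun t => h u t) a y)
               <= Rabs (y - a) * (eps / (2 * B))).
  { apply RInt_dist_le; try (intros; apply cont2_slice2, Hh).
    intros t Ht.
    assert (a - B <= t <= a + B).
    { apply Rabs_le_between in HyB. revert Ht.
      unfold Rmin, Rmax; destruct (Rle_dec a y); lra. }
    apply Rabs_lt_between in Hx1.
    left; apply H1; try lra.
    rewrite Rminus_diag, Rabs_R0; apply cond_pos. }
  assert (H4 : Rabs (y - a) * (eps / (2 * B)) <= B * (eps / (2 * B)))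
    by (apply Rmult_le_compat_r; lra).
  replace (B * (eps / (2 * B))) with (eps / 2) in H4 by (field; lra).
  lra.
Qed.

(** The derivative of a double integral in its inner bound. *)
Lemma is_derive_RInt_RInt (h : R -> R -> R) (a b u v : R) :
  cont2 h ->
  is_derive (fun y => RInt (fun s => RInt (fun t => h s t) b y) a u) v
    (RInt (fun s => h s v) a u).
Proof.
  intros Hh.
  assert (HD : forall s y,
    is_derive (fun z => RInt (fun t => h s t) b z) y (h s y)).
  { intros s y. apply (is_derive_RInt_cont (fun t => h s t)).
    intros x; apply cont2_slice2, Hh. }
  assert (HE : forall s y, Derive (fun z => RInt (fun t => h s t) b z) y = h s y).
  { intros; apply is_derive_unique, HD. }
  rewrite <- (RInt_ext (fun s => Derive (fun z => RInt (fun t => h s t) b z) v)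
                (fun s => h s v)) by (intros; apply HE).
  apply (is_derive_RInt_param (fun y s => RInt (fun t => h s t) b y)).
  - apply filter_forall; intros y s _. eexists; apply HD.
  - intros s _. apply (continuity_2d_pt_ext (fun y s => h s y)).
    + intros; symmetry; apply HE.
    + apply (cont2_swap h Hh).
  - apply filter_forall; intros y. apply ex_RInt_cont; intros x.
    apply (cont2_slice1 (fun s y => RInt (fun t => h s t) b y)).
    apply cont2_RInt, Hh.
Qed.

(** * Derivatives of real functions and open sets of the plane *)

Lemma is_derive_val (f : R -> R) (x a b : R) :
  is_derive f x a -> a = b -> is_derive f x b.
Proof. intros H <-; exact H. Qed.


Lemma is_derive_add (f g : R -> R) (x a b c : R) :
  is_derive f x a -> is_derive g x b -> a + b = c ->
  is_derive (fun y => f y + g y) x c.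
Proof. intros Hf Hg <-. apply (is_derive_plus f g); assumption. Qed.


Lemma is_derive_sub (f g : R -> R) (x a b c : R) :
  is_derive f x a -> is_derive g x b -> a - b = c ->
  is_derive (fun y => f y - g y) x c.
Proof. intros Hf Hg <-. apply (is_derive_minus f g); assumption. Qed.


Lemma is_derive_mul (f g : R -> R) (x a b c : R) :
  is_derive f x a -> is_derive g x b -> a * g x + f x * b = c ->
  is_derive (fun y => f y * g y) x c.
Proof.
  intros Hf Hg <-. apply (is_derive_mult f g); try assumption. exact Rmult_comm.
Qed.


Lemma is_derive_cst (a x : R) : is_derive (fun _ : R => a) x 0.
Proof. apply (@is_derive_const R_AbsRing R_NormedModule a x). Qed.


Lemma locally_dist_lt (c d x : R) :
  Rabs (x - c) < d -> locally x (fun y => Rabs (y - c) < d).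
Proof.
  intros H. assert (He : 0 < d - Rabs (x - c)) by lra.
  exists (mkposreal _ He); intros y Hy.
  change (Rabs (y - x) < d - Rabs (x - c)) in Hy.
  replace (y - c) with ((y - x) + (x - c)) by ring.
  eapply Rle_lt_trans; [apply Rabs_triang|]. lra.
Qed.


Lemma open_square (D : R * R -> Prop) (u v : R) :
  open D -> D (u, v) ->
  exists d : posreal, forall x y, Rabs (x - u) < d -> Rabs (y - v) < d -> D (x, y).
Proof.
  intros HO HD. specialize (HO (u, v) HD).
  apply (locally_2d_locally (fun x y => D (x, y)) u v).
  eapply filter_imp; [|exact HO]. intros [x y] H; exact H.
Qed.

(** * Finite sums *)

(** The sum of [f] over the list [s].  Below, [s] enumerates a finite index type. *)
Definition lsum {I : Type} (s : list I) (f : I -> R) : R :=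
  fold_right (fun i acc => f i + acc) 0 s.

Lemma lsum_ext {I : Type} (s : list I) (f g : I -> R) :
  (forall i, f i = g i) -> lsum s f = lsum s g.
Proof.
  intros H; induction s as [|i s IH]; simpl; [reflexivity|].
  rewrite H, IH; reflexivity.
Qed.

Lemma lsum_plus {I : Type} (s : list I) (f g : I -> R) :
  lsum s (fun i => f i + g i) = lsum s f + lsum s g.
Proof. induction s as [|i s IH]; simpl; [ring|]. rewrite IH; ring. Qed.

Lemma lsum_minus {I : Type} (s : list I) (f g : I -> R) :
  lsum s (fun i => f i - g i) = lsum s f - lsum s g.
Proof. induction s as [|i s IH]; simpl; [ring|]. rewrite IH; ring. Qed.

Lemma lsum_mult_l {I : Type} (s : list I) (c : R) (f : I -> R) :
  lsum s (fun i => c * f i) = c * lsum s f.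
Proof. induction s as [|i s IH]; simpl; [ring|]. rewrite IH; ring. Qed.

Lemma lsum_mult_r {I : Type} (s : list I) (c : R) (f : I -> R) :
  lsum s (fun i => f i * c) = lsum s f * c.
Proof. induction s as [|i s IH]; simpl; [ring|]. rewrite IH; ring. Qed.

Lemma lsum_exchange {I J : Type} (s : list I) (t : list J) (f : I -> J -> R) :
  lsum s (fun i => lsum t (fun j => f i j)) =
  lsum t (fun j => lsum s (fun i => f i j)).
Proof.
  induction s as [|i s IH]; simpl.
  - induction t as [|j t IHt]; simpl; [reflexivity|]. rewrite <- IHt; ring.
  - rewrite IH, <- lsum_plus; reflexivity.
Qed.

Lemma lsum_abs_le {I : Type} (s : list I) (f : I -> R) (c : R) :
  (forall i, Rabs (f i) <= c) -> Rabs (lsum s f) <= INR (length s) * c.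
Proof.
  intros H; induction s as [|i s IH]; cbn [lsum fold_right length].
  - rewrite Rabs_R0; simpl; lra.
  - rewrite S_INR. eapply Rle_trans; [apply Rabs_triang|].
    specialize (H i). unfold lsum in IH. lra.
Qed.

Lemma lsum_ge_term {I : Type} (s : list I) (f : I -> R) (i : I) :
  (forall j, 0 <= f j) -> In i s -> f i <= lsum s f.
Proof.
  intros H; induction s as [|j s IH]; simpl; [tauto|].
  assert (Hs : 0 <= lsum s f).
  { clear IH; induction s as [|k s IH]; simpl; [lra|]. specialize (H k); lra. }
  intros [->|Hi]; [lra|]. specialize (H j); specialize (IH Hi); lra.
Qed.

Lemma is_derive_lsum {I : Type} (s : list I) (f : I -> R -> R) (df : I -> R) (x : R) :
  (forall i, is_derive (f i) x (df i)) ->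
  is_derive (fun y => lsum s (fun i => f i y)) x (lsum s df).
Proof.
  intros H; induction s as [|i s IH]; simpl.
  - apply (@is_derive_const R_AbsRing R_NormedModule 0 x).
  - apply (is_derive_plus (f i) (fun y => lsum s (fun j => f j y))); auto.
Qed.

Lemma continuity_2d_pt_lsum {I : Type} (s : list I) (f : I -> R -> R -> R) (u v : R) :
  (forall i, continuity_2d_pt (f i) u v) ->
  continuity_2d_pt (fun x y => lsum s (fun i => f i x y)) u v.
Proof.
  intros H; induction s as [|i s IH]; simpl.
  - apply continuity_2d_pt_const.
  - apply continuity_2d_pt_plus; auto.
Qed.

(** A finite family of functions continuous at a point has a common local bound. *)
Lemma loc_bounded {J : Type} (s : list J) (F : J -> R -> R -> R) (u v : R) :
  (forall j, continuity_2d_pt (F j) u v) ->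
  exists M, 0 <= M /\
    locally_2d (fun x y => forall j, In j s -> Rabs (F j x y) <= M) u v.
Proof.
  intros H; induction s as [|j s [M [HM [d Hd]]]].
  - exists 0; split; [lra|]. exists (mkposreal 1 Rlt_0_1); simpl; tauto.
  - destruct (H j (mkposreal 1 Rlt_0_1)) as [d1 H1]; simpl in H1.
    exists (Rmax M (Rabs (F j u v) + 1)); split.
    { eapply Rle_trans; [exact HM|apply Rmax_l]. }
    exists (mkposreal _ (Rmin_stable_in_posreal d d1)); simpl.
    intros x y Hx Hy k [<-|Hk].
    + eapply Rle_trans; [|apply Rmax_r].
      specialize (H1 x y (Rlt_le_trans _ _ _ Hx (Rmin_r _ _))
                         (Rlt_le_trans _ _ _ Hy (Rmin_r _ _))).
      replace (F j x y) with ((F j x y - F j u v) + F j u v) by ring.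
      eapply Rle_trans; [apply Rabs_triang|]. lra.
    + eapply Rle_trans; [|apply Rmax_l].
      apply (Hd x y (Rlt_le_trans _ _ _ Hx (Rmin_l _ _))
                    (Rlt_le_trans _ _ _ Hy (Rmin_l _ _)) k Hk).
Qed.

(** * Linear Pfaffian systems *)

(** The retraction of the line onto the interval of centre [c] and radius [d], for
    [0 <= d].  Composing coefficients with it makes them continuous and bounded on the
    whole plane without changing them on the square under consideration. *)
Definition clamp (c d x : R) : R := Rmax (c - d) (Rmin (c + d) x).

Lemma clamp_in (c d x : R) : 0 <= d -> Rabs (clamp c d x - c) <= d.
Proof.
  intros Hd. unfold clamp, Rmax, Rmin.
  destruct (Rle_dec (c + d) x); destruct Rle_dec; apply Rabs_le_between; lra.
Qed.

Lemma clamp_id (c d x : R) : Rabs (x - c) <= d -> clamp c d x = x.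
Proof.
  intros H; apply Rabs_le_between in H. unfold clamp, Rmax, Rmin.
  destruct (Rle_dec (c + d) x); destruct Rle_dec; lra.
Qed.

Lemma continuous_clamp (c d x : R) : continuous (clamp c d) x.
Proof.
  apply continuity_pt_filterlim, continuity_pt_locally. intros eps.
  exists eps; intros y Hy. change (Rabs (y - x) < eps) in Hy.
  eapply Rle_lt_trans; [|exact Hy].
  change (Rabs (clamp c d y - clamp c d x) <= Rabs (y - x)).
  unfold clamp, Rmax, Rmin.
  destruct (Rle_dec (c + d) x); destruct (Rle_dec (c + d) y);
  repeat (match goal with |- context [Rle_dec ?a ?b] => destruct (Rle_dec a b) end);
  unfold Rabs; repeat destruct Rcase_abs; lra.
Qed.

Lemma cont2_clamp (f : R -> R -> R) (u0 v0 d : R) :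
  0 <= d ->
  (forall u v, Rabs (u - u0) <= d -> Rabs (v - v0) <= d -> continuity_2d_pt f u v) ->
  cont2 (fun u v => f (clamp u0 d u) (clamp v0 d v)).
Proof.
  intros Hd H u v eps.
  destruct (H (clamp u0 d u) (clamp v0 d v) (clamp_in _ _ _ Hd) (clamp_in _ _ _ Hd)
              eps) as [e He].
  assert (Hc1 := cont2_of_1d (clamp u0 d) (continuous_clamp u0 d)).
  assert (Hc2 := cont2_swap _ (cont2_of_1d (clamp v0 d) (continuous_clamp v0 d))).
  destruct (Hc1 u v e) as [d1 H1]. destruct (Hc2 u v e) as [d2 H2].
  exists (mkposreal _ (Rmin_stable_in_posreal d1 d2)); simpl.
  intros x y Hx Hy. apply He.
  - apply (H1 x y); (eapply Rlt_le_trans; [eassumption|apply Rmin_l]).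
  - apply (H2 x y); (eapply Rlt_le_trans; [eassumption|apply Rmin_r]).
Qed.

(** The Goursat problem [A_uv = k A] with data solving [A_u = p A] on one axis and
    [A_v = q A] on the other, in integral form on a small square. *)
Lemma goursat {I : Type} (s : list I) (Hs : forall i, In i s)
  (p q k : I -> I -> R -> R -> R) (u0 v0 M d : R) (a : I -> R)
  (Hp : forall i j, cont2 (p i j)) (Hq : forall i j, cont2 (q i j))
  (Hk : forall i j, cont2 (k i j))
  (HM : forall i j u v,
     Rabs (p i j u v) <= M /\ Rabs (q i j u v) <= M /\ Rabs (k i j u v) <= M)
  (Hd : 0 <= d <= 1) (Hsmall : 3 * (d * (INR (length s) * M)) <= / 2) :
  exists (A : I -> R -> R -> R) (b : R),
    (forall i, cont2 (A i)) /\ (forall i u v, Rabs (A i u v) <= b) /\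
    forall i u v, Rabs (u - u0) <= d -> Rabs (v - v0) <= d ->
      A i u v = a i
        + RInt (fun x => lsum s (fun j => p i j x v0 * A j x v0)) u0 u
        + RInt (fun y => lsum s (fun j => q i j u0 y * A j u0 y)) v0 v
        + RInt (fun x => RInt (fun y => lsum s (fun j => k i j x y * A j x y)) v0 v)
            u0 u.
Proof.
  (* The upper bounds are clamped so that the operator contracts on the whole plane. *)
  pose (dot := fun (m : I -> I -> R -> R -> R) (f : I * (R * R) -> R) i x y =>
    lsum s (fun j => m i j x y * f (j, (x, y)))).
  pose (Phi := fun (f : I * (R * R) -> R) (w : I * (R * R)) =>
    let i := fst w in let u := fst (snd w) in let v := snd (snd w) in
    a i
    + RInt (fun x => dot p f i x v0) u0 (clamp u0 d u)
    + RInt (fun y => dot q f i u0 y) v0 (clamp v0 d v)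
    + RInt (fun x => RInt (fun y => dot k f i x y) v0 (clamp v0 d v))
           u0 (clamp u0 d u)).
  pose (C := fun f : I * (R * R) -> R => forall i, cont2 (fun u v => f (i, (u, v)))).
  assert (Cdot : forall m f i, (forall i j, cont2 (m i j)) -> C f ->
            cont2 (dot m f i)).
  { intros m f i Hm Hf u v. apply (continuity_2d_pt_lsum s
      (fun j x y => m i j x y * f (j, (x, y)))). intros j.
    apply continuity_2d_pt_mult; [apply Hm|apply Hf]. }
  assert (dot_dist : forall m f g c i x y,
    (forall i j u v, Rabs (m i j u v) <= M) -> (forall w, Rabs (f w - g w) <= c) ->
    Rabs (dot m f i x y - dot m g i x y) <= INR (length s) * (M * c)).
  { intros m f g c i x y Hm Hfg. unfold dot. rewrite <- lsum_minus.
    apply lsum_abs_le; intros j. rewrite <- Rmult_minus_distr_l, Rabs_mult.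
    apply Rmult_le_compat; try apply Rabs_pos; auto. }
  assert (Hcl1 := cont2_of_1d (clamp u0 d) (continuous_clamp u0 d)).
  assert (Hcl2 := cont2_swap _ (cont2_of_1d (clamp v0 d) (continuous_clamp v0 d))).
  simpl in Hcl2.
  assert (Hcst : forall c, cont2 (fun _ _ => c))
    by (intros c x y; apply continuity_2d_pt_const).
  assert (Hpr1 : cont2 (fun x _ => x)) by (intros x y; apply continuity_2d_pt_id1).
  assert (Hpr2 : cont2 (fun _ y => y)) by (intros x y; apply continuity_2d_pt_id2).
  destruct (halving_fixed_point C Phi (fun _ => 0)
    (lsum s (fun i => Rabs (a i)))) as [f [Cf [Hf Hbd]]].
  - intros f H i. apply cont2_uniform_limit. intros eps He.
    destruct (H eps He) as [g [Cg Hg]].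
    exists (fun u v => g (i, (u, v))); split; [apply Cg|]. intros; apply Hg.
  - intros f Cf i. unfold Phi; simpl.
    intros u v. apply continuity_2d_pt_plus; [apply continuity_2d_pt_plus;
      [apply continuity_2d_pt_plus; [apply continuity_2d_pt_const|]|]|].
    + apply (cont2_comp (fun (_ y : R) => RInt (fun x => dot p f i x v0) u0 y)
               (fun x _ => x) (fun x _ => clamp u0 d x)); [|exact Hpr1|exact Hcl1].
      apply (cont2_RInt (fun _ x => dot p f i x v0)).
      apply (cont2_comp (dot p f i) (fun _ y => y) (fun _ _ => v0)); auto.
    + apply (cont2_comp (fun (_ y : R) => RInt (fun x => dot q f i u0 x) v0 y)
               (fun x _ => x) (fun _ y => clamp v0 d y)); [|exact Hpr1|exact Hcl2].
      apply (cont2_RInt (fun _ x => dot q f i u0 x)).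
      apply (cont2_comp (dot q f i) (fun _ _ => u0) (fun _ y => y)); auto.
    + apply (cont2_comp (fun y x => RInt (fun z =>
               RInt (fun t => dot k f i z t) v0 y) u0 x)
               (fun _ y => clamp v0 d y) (fun x _ => clamp u0 d x));
        [|exact Hcl2|exact Hcl1].
      apply (cont2_RInt (fun y z => RInt (fun t => dot k f i z t) v0 y)).
      apply (cont2_swap (fun z y => RInt (fun t => dot k f i z t) v0 y)).
      apply cont2_RInt. auto.
  - intros f g c Cf Cg Hfg [i [u v]]. unfold Phi; simpl.
    assert (Hc : 0 <= c) by (eapply Rle_trans; [apply Rabs_pos|apply (Hfg (i, (u, v)))]).
    set (N := INR (length s)) in *.
    assert (HN : 0 <= N) by apply pos_INR.
    assert (HM0 : 0 <= M)
      by (eapply Rle_trans; [apply Rabs_pos|apply (HM i i u v)]).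
    assert (HNM : 0 <= N * (M * c)).
    { apply Rmult_le_pos; [exact HN|apply Rmult_le_pos; assumption]. }
    pose proof (clamp_in u0 d u (proj1 Hd)) as Bu.
    pose proof (clamp_in v0 d v (proj1 Hd)) as Bv.
    assert (H1 : Rabs (RInt (fun x => dot p f i x v0) u0 (clamp u0 d u)
                  - RInt (fun x => dot p g i x v0) u0 (clamp u0 d u))
                 <= d * (N * (M * c))).
    { eapply Rle_trans; [apply RInt_dist_le with (c := N * (M * c))|].
      - intros x; apply (cont2_slice1 (dot p f i)); auto.
      - intros x; apply (cont2_slice1 (dot p g i)); auto.
      - intros x _; apply dot_dist; [intros; apply HM|exact Hfg].
      - apply Rmult_le_compat_r; assumption. }
    assert (H2 : Rabs (RInt (fun y => dot q f i u0 y) v0 (clamp v0 d v)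
                  - RInt (fun y => dot q g i u0 y) v0 (clamp v0 d v))
                 <= d * (N * (M * c))).
    { eapply Rle_trans; [apply RInt_dist_le with (c := N * (M * c))|].
      - intros x; apply (cont2_slice2 (dot q f i)); auto.
      - intros x; apply (cont2_slice2 (dot q g i)); auto.
      - intros x _; apply dot_dist; [intros; apply HM|exact Hfg].
      - apply Rmult_le_compat_r; assumption. }
    assert (H3 : Rabs (RInt (fun x => RInt (fun y => dot k f i x y) v0 (clamp v0 d v))
                         u0 (clamp u0 d u)
                  - RInt (fun x => RInt (fun y => dot k g i x y) v0 (clamp v0 d v))
                         u0 (clamp u0 d u))
                 <= d * (N * (M * c))).
    { eapply Rle_trans; [apply RInt_dist_le with (c := N * (M * c))|].
      - intros x; apply (cont2_slice1 (fun x y => RInt (fun t => dot k f i x t) v0 y)).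
        apply cont2_RInt; auto.
      - intros x; apply (cont2_slice1 (fun x y => RInt (fun t => dot k g i x t) v0 y)).
        apply cont2_RInt; auto.
      - intros x _.
        eapply Rle_trans; [apply RInt_dist_le with (c := N * (M * c))|].
        + intros y; apply (cont2_slice2 (dot k f i)); auto.
        + intros y; apply (cont2_slice2 (dot k g i)); auto.
        + intros y _; apply dot_dist; [intros; apply HM|exact Hfg].
        + rewrite <- (Rmult_1_l (N * (M * c))) at 2.
          apply Rmult_le_compat_r; [assumption|lra].
      - apply Rmult_le_compat_r; assumption. }
    assert (H4 : 3 * (d * (N * (M * c))) <= c / 2).
    { replace (3 * (d * (N * (M * c)))) with (3 * (d * (N * M)) * c) by ring.
      unfold Rdiv; rewrite (Rmult_comm c). apply Rmult_le_compat_r; assumption. }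
    match goal with |- Rabs (a i + ?x1 + ?x2 + ?x3 - (a i + ?y1 + ?y2 + ?y3)) <= _ =>
      replace (a i + x1 + x2 + x3 - (a i + y1 + y2 + y3))
        with ((x1 - y1) + ((x2 - y2) + (x3 - y3))) by ring;
      pose proof (Rabs_triang (x1 - y1) ((x2 - y2) + (x3 - y3)));
      pose proof (Rabs_triang (x2 - y2) (x3 - y3))
    end. lra.
  - intros i; apply Hcst.
  - intros [i [u v]]. unfold Phi, dot; simpl.
    assert (H0 : forall (m : I -> I -> R -> R -> R) x y,
      lsum s (fun j => m i j x y * 0) = 0).
    { intros m x y. rewrite lsum_mult_r; ring. }
    assert (R0 : forall g x y, (forall z, g z = 0) -> RInt g x y = 0).
    { intros g x y Hg. rewrite (RInt_ext g (fun _ => 0)) by (intros; apply Hg).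
      rewrite RInt_const. apply Rmult_0_r. }
    rewrite !R0; try (intros; try apply R0; intros; apply H0).
    rewrite !Rplus_0_r, Rminus_0_r.
    apply (lsum_ge_term s (fun i => Rabs (a i)) i); [intros; apply Rabs_pos|apply Hs].
  - exists (fun i u v => f (i, (u, v))), (2 * lsum s (fun i => Rabs (a i))).
    split; [exact Cf|]. split.
    + intros i u v. specialize (Hbd (i, (u, v))). rewrite Rminus_0_r in Hbd. exact Hbd.
    + intros i u v Hu Hv. rewrite <- (Hf (i, (u, v))) at 1. unfold Phi; simpl.
      rewrite !clamp_id by assumption. reflexivity.
Qed.

(** On a small square, bounded solutions of [W_v = - P Z], [Z_u = - Q W] with zero data
    on the axes vanish: a common bound of both can be halved forever. *)
Lemma characteristic_zero {I : Type} (s : list I) (P Q : I -> I -> R -> R -> R)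
  (W Z : I -> R -> R -> R) (u0 v0 M d b : R)
  (HM : forall i j u v, Rabs (u - u0) < d -> Rabs (v - v0) < d ->
     Rabs (P i j u v) <= M /\ Rabs (Q i j u v) <= M)
  (Hsmall : d * (INR (length s) * M) <= / 2)
  (HW : forall i u v, Rabs (u - u0) < d -> Rabs (v - v0) < d ->
     is_derive (fun y => W i u y) v (- lsum s (fun k => P i k u v * Z k u v)))
  (HZ : forall i u v, Rabs (u - u0) < d -> Rabs (v - v0) < d ->
     is_derive (fun x => Z i x v) u (- lsum s (fun k => Q i k u v * W k u v)))
  (HW0 : forall i u, Rabs (u - u0) < d -> W i u v0 = 0)
  (HZ0 : forall i v, Rabs (v - v0) < d -> Z i u0 v = 0)
  (Hb : forall i u v, Rabs (u - u0) < d -> Rabs (v - v0) < d ->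
     Rabs (W i u v) <= b /\ Rabs (Z i u v) <= b) :
  forall i u v, Rabs (u - u0) < d -> Rabs (v - v0) < d -> W i u v = 0 /\ Z i u v = 0.
Proof.
  assert (Hhalf : forall c,
    (forall i u v, Rabs (u - u0) < d -> Rabs (v - v0) < d ->
       Rabs (W i u v) <= c /\ Rabs (Z i u v) <= c) ->
    (forall i u v, Rabs (u - u0) < d -> Rabs (v - v0) < d ->
       Rabs (W i u v) <= c / 2 /\ Rabs (Z i u v) <= c / 2)).
  { intros c Hc.
    assert (Hdot : forall (m : I -> I -> R -> R -> R) (f : I -> R -> R -> R) i u v,
      (forall i j, Rabs (m i j u v) <= M) -> (forall i, Rabs (f i u v) <= c) ->
      Rabs (- lsum s (fun k => m i k u v * f k u v)) <= INR (length s) * (M * c)).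
    { intros m f i u v Hm Hf. rewrite Rabs_Ropp. apply lsum_abs_le; intros k.
      rewrite Rabs_mult. apply Rmult_le_compat; try apply Rabs_pos; auto. }
    assert (Hfin : forall (i : I) u v x, Rabs (u - u0) < d -> Rabs (v - v0) < d ->
      Rabs x < d -> INR (length s) * (M * c) * Rabs x <= c / 2).
    { intros i u v x Hu Hv Hx.
      assert (0 <= c) by (eapply Rle_trans; [apply Rabs_pos|apply (Hc i u v Hu Hv)]).
      assert (0 <= M)
        by (eapply Rle_trans; [apply Rabs_pos|apply (HM i i u v Hu Hv)]).
      apply Rle_trans with (INR (length s) * (M * c) * d).
      - apply Rmult_le_compat_l; [|lra].
        apply Rmult_le_pos; [apply pos_INR|apply Rmult_le_pos; assumption].
      - replace (INR (length s) * (M * c) * d)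
          with (d * (INR (length s) * M) * c) by ring.
        unfold Rdiv; rewrite (Rmult_comm c). apply Rmult_le_compat_r; assumption. }
    intros i u v Hu Hv; split.
    - rewrite <- (Rminus_0_r (W i u v)), <- (HW0 i u Hu).
      eapply Rle_trans;
        [apply (bounded_variation (fun y => W i u y)
                  (fun y => - lsum s (fun k => P i k u y * Z k u y))
                  (INR (length s) * (M * c)))|apply (Hfin i u v); assumption].
      intros y Hy. assert (Hyd : Rabs (y - v0) < d) by lra. split.
      + apply HW; assumption.
      + apply Hdot; intros; [apply HM|apply Hc]; assumption.
    - rewrite <- (Rminus_0_r (Z i u v)), <- (HZ0 i v Hv).
      eapply Rle_trans;
        [apply (bounded_variation (fun x => Z i x v)
                  (fun x => - lsum s (fun k => Q i k x v * W k x v))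
                  (INR (length s) * (M * c)))|apply (Hfin i u v); assumption].
      intros x Hx. assert (Hxd : Rabs (x - u0) < d) by lra. split.
      + apply HZ; assumption.
      + apply (Hdot Q W i x v); intros; [apply HM|apply Hc]; assumption. }
  assert (Hiter : forall n i u v, Rabs (u - u0) < d -> Rabs (v - v0) < d ->
       Rabs (W i u v) <= b * (/ 2) ^ n /\ Rabs (Z i u v) <= b * (/ 2) ^ n).
  { intros n; induction n as [|n IH].
    - simpl; rewrite Rmult_1_r; exact Hb.
    - intros i u v Hu Hv. simpl.
      replace (b * (/ 2 * (/ 2) ^ n)) with (b * (/ 2) ^ n / 2) by field.
      apply Hhalf; assumption. }
  assert (Hlim : forall x, (forall n, Rabs x <= b * (/ 2) ^ n) -> x = 0).
  { intros x Hx.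
    assert (Hl : is_lim_seq (fun n => b * (/ 2) ^ n) (b * 0)).
    { apply (is_lim_seq_scal_l (fun n => (/ 2) ^ n) b 0).
      apply is_lim_seq_geom. rewrite Rabs_pos_eq; lra. }
    pose proof (is_lim_seq_le _ _ _ _ Hx (is_lim_seq_const (Rabs x)) Hl) as H.
    simpl in H. rewrite Rmult_0_r in H.
    pose proof (Rabs_pos x). apply Rabs_eq_0. lra. }
  intros i u v Hu Hv; split; apply Hlim; intros n; apply Hiter; assumption.
Qed.

(** The cancellation behind the equations for the defects [A_u - P A] and [A_v - Q A]
    of the solution of the characteristic problem. *)
Lemma pfaffian_cancel {I : Type} (s : list I) (x P A C : I -> R) (Q : I -> I -> R) :
  lsum s (fun j => (x j + lsum s (fun k => P k * Q k j)) * A j)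
  - lsum s (fun j => x j * A j + P j * C j)
  = - lsum s (fun k => P k * (C k - lsum s (fun j => Q k j * A j))).
Proof.
  rewrite (lsum_ext s (fun k => P k * (C k - _))
             (fun k => P k * C k - lsum s (fun j => P k * Q k j * A j))).
  2:{ intros k. rewrite Rmult_minus_distr_l, <- lsum_mult_l. f_equal.
      apply lsum_ext; intros; ring. }
  rewrite (lsum_ext s (fun j => (x j + _) * A j)
             (fun j => x j * A j + lsum s (fun k => P k * Q k j * A j))).
  2:{ intros j. rewrite Rmult_plus_distr_r, <- lsum_mult_r. reflexivity. }
  rewrite !lsum_plus, lsum_minus.
  rewrite (lsum_exchange s s (fun k j => P k * Q k j * A j)). ring.
Qed.

(** A linear system [A_u = P A], [A_v = Q A] satisfying the integrability condition
    [P_v + P Q = Q_u + Q P] is solvable on a square independent of the initial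
    value. *)
Lemma pfaffian_exists {I : Type} (s : list I) (Hs : forall i, In i s)
  (P Q : I -> I -> R -> R -> R) (D : R * R -> Prop) (u0 v0 : R)
  (D_open : open D) (D0 : D (u0, v0))
  (HP : forall i j u v, D (u, v) -> ex_diff_n (P i j) 1 u v)
  (HQ : forall i j u v, D (u, v) -> ex_diff_n (Q i j) 1 u v)
  (compat : forall i j u v, D (u, v) ->
     dv (P i j) u v + lsum s (fun k => P i k u v * Q k j u v) =
     du (Q i j) u v + lsum s (fun k => Q i k u v * P k j u v)) :
  exists d, 0 < d /\
    (forall u v, Rabs (u - u0) < d -> Rabs (v - v0) < d -> D (u, v)) /\
    forall a : I -> R, exists A : I -> R -> R -> R,
      (forall i, A i u0 v0 = a i) /\ (forall i, cont2 (A i)) /\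
      forall i u v, Rabs (u - u0) < d -> Rabs (v - v0) < d ->
        is_derive (fun x => A i x v) u (lsum s (fun j => P i j u v * A j u v)) /\
        is_derive (fun y => A i u y) v (lsum s (fun j => Q i j u v * A j u v)).
Proof.
  pose (K := fun i j u v => dv (P i j) u v + lsum s (fun k => P i k u v * Q k j u v)).
  assert (HPc : forall i j u v, D (u, v) -> continuity_2d_pt (P i j) u v)
    by (intros; apply (HP i j u v); assumption).
  assert (HQc : forall i j u v, D (u, v) -> continuity_2d_pt (Q i j) u v)
    by (intros; apply (HQ i j u v); assumption).
  assert (HKc : forall i j u v, D (u, v) -> continuity_2d_pt (K i j) u v).
  { intros i j u v HD. apply continuity_2d_pt_plus.
    - apply (HP i j u v HD).
    - apply (continuity_2d_pt_lsum s (fun k x y => P i k x y * Q k j x y)).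
      intros k. apply continuity_2d_pt_mult; auto. }
  destruct (open_square D u0 v0 D_open D0) as [d0 Hd0].
  destruct (loc_bounded (list_prod s s) (fun ij => P (fst ij) (snd ij)) u0 v0)
    as [M1 [HM1 [d1 Hd1]]]; [intros; apply HPc, D0|].
  destruct (loc_bounded (list_prod s s) (fun ij => Q (fst ij) (snd ij)) u0 v0)
    as [M2 [HM2 [d2 Hd2]]]; [intros; apply HQc, D0|].
  destruct (loc_bounded (list_prod s s) (fun ij => K (fst ij) (snd ij)) u0 v0)
    as [M3 [HM3 [d3 Hd3]]]; [intros; apply HKc, D0|].
  pose (M := M1 + M2 + M3). pose (N := INR (length s)).
  assert (HN : 0 <= N) by apply pos_INR.
  assert (HM0 : 0 <= M) by (unfold M; lra).
  assert (HNM : 0 <= N * M) by (apply Rmult_le_pos; assumption).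
  assert (Hex : exists d, 0 < d /\ d <= 1 /\ d < d0 /\ d < d1 /\ d < d2 /\ d < d3 /\
                  d <= / (6 * (N * M + 1))).
  { assert (Hi : 0 < / (6 * (N * M + 1))) by (apply Rinv_0_lt_compat; lra).
    pose (m := Rmin (Rmin d0 d1) (Rmin d2 d3)).
    assert (Hm : 0 < m) by (repeat apply Rmin_glb_lt; apply cond_pos).
    assert (m <= d0 /\ m <= d1 /\ m <= d2 /\ m <= d3).
    { pose proof (Rmin_l (Rmin d0 d1) (Rmin d2 d3)).
      pose proof (Rmin_r (Rmin d0 d1) (Rmin d2 d3)).
      pose proof (Rmin_l d0 d1). pose proof (Rmin_r d0 d1).
      pose proof (Rmin_l d2 d3). pose proof (Rmin_r d2 d3). unfold m; lra. }
    exists (Rmin (m / 2) (Rmin 1 (/ (6 * (N * M + 1))))).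
    pose proof (Rmin_l (m / 2) (Rmin 1 (/ (6 * (N * M + 1))))).
    pose proof (Rmin_r (m / 2) (Rmin 1 (/ (6 * (N * M + 1))))).
    pose proof (Rmin_l 1 (/ (6 * (N * M + 1)))).
    pose proof (Rmin_r 1 (/ (6 * (N * M + 1)))).
    split; [repeat apply Rmin_glb_lt; lra|]. lra. }
  destruct Hex as (d & Hd & Hdle1 & Hdd0 & Hdd1 & Hdd2 & Hdd3 & HdM).
  assert (Hsmall : 3 * (d * (N * M)) <= / 2).
  { assert (d * (N * M + 1) <= / 6).
    { apply Rle_trans with (/ (6 * (N * M + 1)) * (N * M + 1)).
      - apply Rmult_le_compat_r; lra.
      - right; field; lra. }
    lra. }
  assert (HD : forall u v, Rabs (u - u0) <= d -> Rabs (v - v0) <= d -> D (u, v))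
    by (intros; apply Hd0; lra).
  assert (HB : forall i j u v, Rabs (u - u0) <= d -> Rabs (v - v0) <= d ->
     Rabs (P i j u v) <= M /\ Rabs (Q i j u v) <= M /\ Rabs (K i j u v) <= M).
  { intros i j u v Hu Hv.
    assert (Hij : In (i, j) (list_prod s s)) by (apply in_prod; apply Hs).
    specialize (Hd1 u v ltac:(lra) ltac:(lra) _ Hij).
    specialize (Hd2 u v ltac:(lra) ltac:(lra) _ Hij).
    specialize (Hd3 u v ltac:(lra) ltac:(lra) _ Hij).
    simpl in Hd1, Hd2, Hd3. unfold M; lra. }
  exists d; split; [exact Hd|]; split; [intros; apply HD; lra|].
  intros a.
  pose (cl := fun (m : I -> I -> R -> R -> R) i j u v =>
                m i j (clamp u0 d u) (clamp v0 d v)).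
  assert (Hclid : forall m i j u v, Rabs (u - u0) <= d -> Rabs (v - v0) <= d ->
            cl m i j u v = m i j u v).
  { intros m i j u v Hu Hv; unfold cl. rewrite !clamp_id by assumption; reflexivity. }
  assert (Hd' : 0 <= d) by lra.
  destruct (goursat s Hs (cl P) (cl Q) (cl K) u0 v0 M d a) as (A & b & HA & Hb & HAeq).
  { intros i j. apply (cont2_clamp (P i j)); auto. }
  { intros i j. apply (cont2_clamp (Q i j)); auto. }
  { intros i j. apply (cont2_clamp (K i j)); auto. }
  { intros i j u v. apply HB; apply clamp_in, Hd'. }
  { lra. } { exact Hsmall. }
  assert (Hclc : forall m i, (forall i j, cont2 (cl m i j)) ->
            cont2 (fun x y => lsum s (fun j => cl m i j x y * A j x y))).
  { intros m i Hm u v.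
    apply (continuity_2d_pt_lsum s (fun j x y => cl m i j x y * A j x y)).
    intros j; apply continuity_2d_pt_mult; [apply Hm|apply HA]. }
  assert (HcP := fun i => Hclc P i
     (fun i j => cont2_clamp (P i j) u0 v0 d Hd'
        (fun u v a b => HPc i j u v (HD u v a b)))).
  assert (HcQ := fun i => Hclc Q i
     (fun i j => cont2_clamp (Q i j) u0 v0 d Hd'
        (fun u v a b => HQc i j u v (HD u v a b)))).
  assert (HcK := fun i => Hclc K i
     (fun i j => cont2_clamp (K i j) u0 v0 d Hd'
        (fun u v a b => HKc i j u v (HD u v a b)))).
  clear Hclc.
  set (kA := fun i x y => lsum s (fun j => cl K i j x y * A j x y)) in *.
  set (pA := fun i x y => lsum s (fun j => cl P i j x y * A j x y)) in *.
  set (qA := fun i x y => lsum s (fun j => cl Q i j x y * A j x y)) in *.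
  assert (z0 : Rabs (u0 - u0) < d) by (rewrite Rminus_diag, Rabs_R0; lra).
  assert (z1 : Rabs (v0 - v0) < d) by (rewrite Rminus_diag, Rabs_R0; lra).
  (* The two partial derivatives of A, as given by the integral equation. *)
  pose (B := fun i u v => pA i u v0 + RInt (fun y => kA i u y) v0 v).
  pose (C := fun i u v => qA i u0 v + RInt (fun x => kA i x v) u0 u).
  assert (HAu : forall i u v, Rabs (u - u0) < d -> Rabs (v - v0) < d ->
            is_derive (fun x => A i x v) u (B i u v)).
  { intros i u v Hu Hv.
    apply (is_derive_ext_loc (fun x => a i + RInt (fun x => pA i x v0) u0 x
             + RInt (fun y => qA i u0 y) v0 v
             + RInt (fun x => RInt (fun y => kA i x y) v0 v) u0 x)).
    { eapply filter_imp; [|apply (locally_dist_lt u0 d u Hu)].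
      intros x Hx; simpl in Hx. symmetry; apply HAeq; lra. }
    eapply is_derive_add; [eapply is_derive_add; [eapply is_derive_add;
      [apply is_derive_cst| |reflexivity]|apply is_derive_cst|reflexivity]| |].
    - apply (is_derive_RInt_cont (fun x => pA i x v0)).
      intros x; apply (cont2_slice1 (pA i)), HcP.
    - apply (is_derive_RInt_cont (fun x => RInt (fun y => kA i x y) v0 v)).
      intros x; apply (cont2_slice1 (fun x y => RInt (fun t => kA i x t) v0 y)).
      apply cont2_RInt, HcK.
    - unfold B; ring. }
  assert (HAv : forall i u v, Rabs (u - u0) < d -> Rabs (v - v0) < d ->
            is_derive (fun y => A i u y) v (C i u v)).
  { intros i u v Hu Hv.
    apply (is_derive_ext_loc (fun y => a i + RInt (fun x => pA i x v0) u0 u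
             + RInt (fun y => qA i u0 y) v0 y
             + RInt (fun x => RInt (fun t => kA i x t) v0 y) u0 u)).
    { eapply filter_imp; [|apply (locally_dist_lt v0 d v Hv)].
      intros y Hy; simpl in Hy. symmetry; apply HAeq; lra. }
    eapply is_derive_add; [eapply is_derive_add; [eapply is_derive_add;
      [apply is_derive_cst|apply is_derive_cst|reflexivity]| |reflexivity]| |].
    - apply (is_derive_RInt_cont (fun x => qA i u0 x)).
      intros x; apply (cont2_slice2 (qA i)), HcQ.
    - apply (is_derive_RInt_RInt (kA i)), HcK.
    - unfold C; ring. }
  (* The defects, whose vanishing is the theorem. *)
  pose (W := fun i u v => B i u v - lsum s (fun j => P i j u v * A j u v)).
  pose (Z := fun i u v => C i u v - lsum s (fun j => Q i j u v * A j u v)).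
  assert (HkA : forall i u v, Rabs (u - u0) < d -> Rabs (v - v0) < d ->
            kA i u v = lsum s (fun j => K i j u v * A j u v)).
  { intros i u v Hu Hv; apply lsum_ext; intros j. rewrite Hclid by lra; reflexivity. }
  assert (Hdot : forall (m : I -> I -> R -> R -> R) i u v,
            (forall i j, Rabs (m i j u v) <= M) ->
            Rabs (lsum s (fun j => m i j u v * A j u v)) <= N * (M * b)).
  { intros m i u v Hm. apply lsum_abs_le; intros j. rewrite Rabs_mult.
    apply Rmult_le_compat; try apply Rabs_pos; auto. }
  assert (HclM : forall i j u v, Rabs (cl P i j u v) <= M /\
            Rabs (cl Q i j u v) <= M /\ Rabs (cl K i j u v) <= M)
    by (intros; apply HB; apply clamp_in, Hd').
  assert (HWZ : forall i u v, Rabs (u - u0) < d -> Rabs (v - v0) < d ->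
                  W i u v = 0 /\ Z i u v = 0).
  { apply (characteristic_zero s P Q W Z u0 v0 M d (3 * (N * (M * b)))).
    - intros i j u v Hu Hv. destruct (HB i j u v) as (h1 & h2 & h3); lra.
    - fold N. lra.
    - intros i u v Hu Hv. unfold W, B.
      eapply is_derive_sub; [eapply is_derive_add; [apply is_derive_cst| |reflexivity]| |].
      + apply (is_derive_RInt_cont (fun y => kA i u y)).
        intros y; apply (cont2_slice2 (kA i)), HcK.
      + apply (is_derive_lsum s (fun j y => P i j u y * A j u y)
          (fun j => dv (P i j) u v * A j u v + P i j u v * C j u v)).
        intros j. eapply is_derive_mul; [|apply HAv; assumption|reflexivity].
        apply Derive_correct. apply (HP i j u v). apply HD; lra.
      + rewrite Rplus_0_l, HkA by assumption. unfold Z.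
        apply (pfaffian_cancel s (fun j => dv (P i j) u v) (fun j => P i j u v)
                 (fun j => A j u v) (fun j => C j u v) (fun k j => Q k j u v)).
    - intros i u v Hu Hv. unfold Z, C.
      eapply is_derive_sub; [eapply is_derive_add; [apply is_derive_cst| |reflexivity]| |].
      + apply (is_derive_RInt_cont (fun x => kA i x v)).
        intros x; apply (cont2_slice1 (kA i)), HcK.
      + apply (is_derive_lsum s (fun j x => Q i j x v * A j x v)
          (fun j => du (Q i j) u v * A j u v + Q i j u v * B j u v)).
        intros j. eapply is_derive_mul; [|apply HAu; assumption|reflexivity].
        apply Derive_correct. apply (HQ i j u v). apply HD; lra.
      + rewrite Rplus_0_l, HkA by assumption. unfold W.
        rewrite <- (pfaffian_cancel s (fun j => du (Q i j) u v) (fun j => Q i j u v)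
                 (fun j => A j u v) (fun j => B j u v) (fun k j => P k j u v)).
        f_equal. apply lsum_ext; intros j. unfold K. rewrite compat by (apply HD; lra).
        reflexivity.
    - intros i u Hu. unfold W, B. rewrite RInt_point.
      change (zero : R) with 0. rewrite Rplus_0_r. apply Rminus_diag_eq.
      apply lsum_ext; intros j. rewrite Hclid by lra; reflexivity.
    - intros i v Hv. unfold Z, C. rewrite RInt_point.
      change (zero : R) with 0. rewrite Rplus_0_r. apply Rminus_diag_eq.
      apply lsum_ext; intros j. rewrite Hclid by lra; reflexivity.
    - intros i u v Hu Hv.
      set (c := N * (M * b)) in *.
      assert (Hc : 0 <= c).
      { eapply Rle_trans; [apply Rabs_pos|apply (Hdot (cl P) i u v)].
        intros; apply HclM. }
      assert (Hc1 : forall t, Rabs t < d -> Rabs t * c <= c).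
      { intros t Ht. rewrite <- (Rmult_1_l c) at 2. apply Rmult_le_compat_r; lra. }
      split.
      + unfold W, B.
        pose proof (Hdot (cl P) i u v0 (fun i j => proj1 (HclM i j u v0))) as h1.
        pose proof (Hdot P i u v (fun i j => proj1 (HB i j u v
          (Rlt_le _ _ Hu) (Rlt_le _ _ Hv)))) as h2.
        assert (h3 : Rabs (RInt (fun y => kA i u y) v0 v) <= Rabs (v - v0) * c).
        { apply RInt_abs_le; [intros x; apply (cont2_slice2 (kA i)), HcK|].
          intros x _. apply Hdot. intros; apply HclM. }
        specialize (Hc1 _ Hv). unfold pA.
        match goal with |- Rabs (?x + ?y - ?z) <= _ =>
          pose proof (Rabs_triang (x + y) (- z)); pose proof (Rabs_triang x y);
          pose proof (Rabs_Ropp z); replace (x + y - z) with (x + y + - z) by ring end.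
        lra.
      + unfold Z, C.
        pose proof (Hdot (cl Q) i u0 v (fun i j => proj1 (proj2 (HclM i j u0 v)))) as h1.
        pose proof (Hdot Q i u v (fun i j => proj1 (proj2 (HB i j u v
          (Rlt_le _ _ Hu) (Rlt_le _ _ Hv))))) as h2.
        assert (h3 : Rabs (RInt (fun x => kA i x v) u0 u) <= Rabs (u - u0) * c).
        { apply RInt_abs_le; [intros x; apply (cont2_slice1 (kA i)), HcK|].
          intros x _. apply (Hdot (cl K)). intros; apply HclM. }
        specialize (Hc1 _ Hu). unfold qA.
        match goal with |- Rabs (?x + ?y - ?z) <= _ =>
          pose proof (Rabs_triang (x + y) (- z)); pose proof (Rabs_triang x y);
          pose proof (Rabs_Ropp z); replace (x + y - z) with (x + y + - z) by ring end.
        lra. }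
  exists A. split; [|split; [exact HA|]].
  - intros i. rewrite HAeq by lra. rewrite !RInt_point.
    change (zero : R) with 0. ring.
  - intros i u v Hu Hv. destruct (HWZ i u v Hu Hv) as [h1 h2].
    apply Rminus_diag_uniq in h1, h2. rewrite <- h1, <- h2. auto.
Qed.

(** * Smooth functions on an open set *)

(** Functions of class [C^n] on [D]. *)
Definition class_on (D : R * R -> Prop) (n : nat) (f : R -> R -> R) : Prop :=
  forall u v, D (u, v) -> ex_diff_n f n u v.

Lemma locally_2d_open (D : R * R -> Prop) (u v : R) :
  open D -> D (u, v) -> locally_2d (fun x y => D (x, y)) u v.
Proof.
  intros HO HD. destruct (open_square D u v HO HD) as [d Hd].
  exists d; exact Hd.
Qed.

Lemma locally_open1 (D : R * R -> Prop) (u v : R) :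
  open D -> D (u, v) -> locally u (fun x => D (x, v)).
Proof.
  intros HO HD.
  apply (locally_2d_1d_const_y (fun x y => D (x, y)) u v), locally_2d_open; assumption.
Qed.

Lemma locally_open2 (D : R * R -> Prop) (u v : R) :
  open D -> D (u, v) -> locally v (fun y => D (u, y)).
Proof.
  intros HO HD.
  apply (locally_2d_1d_const_x (fun x y => D (x, y)) u v), locally_2d_open; assumption.
Qed.

Lemma du_ext_on (D : R * R -> Prop) (f g : R -> R -> R) (u v : R) :
  open D -> D (u, v) -> (forall x y, D (x, y) -> f x y = g x y) ->
  du f u v = du g u v.
Proof.
  intros HO HD H. apply Derive_ext_loc.
  eapply filter_imp; [|apply (locally_open1 D u v HO HD)]. intros x Hx; auto.
Qed.

Lemma dv_ext_on (D : R * R -> Prop) (f g : R -> R -> R) (u v : R) :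
  open D -> D (u, v) -> (forall x y, D (x, y) -> f x y = g x y) ->
  dv f u v = dv g u v.
Proof.
  intros HO HD H. apply Derive_ext_loc.
  eapply filter_imp; [|apply (locally_open2 D u v HO HD)]. intros x Hx; auto.
Qed.

Lemma class_on_ext (D : R * R -> Prop) (n : nat) (f g : R -> R -> R) :
  open D -> (forall u v, D (u, v) -> f u v = g u v) ->
  class_on D n f -> class_on D n g.
Proof.
  intros HO H Hf u v HD. apply (ex_diff_n_ext_loc f).
  - destruct (open_square D u v HO HD) as [d Hd].
    exists d; intros; apply H, Hd; assumption.
  - apply Hf, HD.
Qed.

Lemma class_on_S (D : R * R -> Prop) (n : nat) (f fu fv : R -> R -> R) :
  open D ->
  (forall u v, D (u, v) -> continuity_2d_pt f u v) ->
  (forall u v, D (u, v) -> is_derive (fun x => f x v) u (fu u v)) ->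
  (forall u v, D (u, v) -> is_derive (fun y => f u y) v (fv u v)) ->
  class_on D n fu -> class_on D n fv -> class_on D (S n) f.
Proof.
  intros HO Hc Hu Hv Hfu Hfv u v HD. split; [apply Hc, HD|].
  split; [eexists; apply Hu, HD|]. split; [eexists; apply Hv, HD|]. split.
  - apply (class_on_ext D n fu (du f) HO); [|exact Hfu|exact HD].
    intros x y Hxy. symmetry; apply is_derive_unique, Hu, Hxy.
  - apply (class_on_ext D n fv (dv f) HO); [|exact Hfv|exact HD].
    intros x y Hxy. symmetry; apply is_derive_unique, Hv, Hxy.
Qed.

Lemma class_on_is_du (D : R * R -> Prop) (n : nat) (f : R -> R -> R) (u v : R) :
  class_on D (S n) f -> D (u, v) -> is_derive (fun x => f x v) u (du f u v).
Proof. intros H HD. apply Derive_correct, (H u v HD). Qed.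

Lemma class_on_is_dv (D : R * R -> Prop) (n : nat) (f : R -> R -> R) (u v : R) :
  class_on D (S n) f -> D (u, v) -> is_derive (fun y => f u y) v (dv f u v).
Proof. intros H HD. apply Derive_correct, (H u v HD). Qed.

Lemma class_on_le (D : R * R -> Prop) (n m : nat) (f : R -> R -> R) :
  (m <= n)%nat -> class_on D n f -> class_on D m f.
Proof. intros Hmn H u v HD. apply (ex_diff_n_m n m Hmn), H, HD. Qed.

Lemma class_on_const (D : R * R -> Prop) (n : nat) (c : R) :
  open D -> class_on D n (fun _ _ => c).
Proof.
  intros HO. revert c; induction n as [|n IH]; intros c.
  - intros u v _; split; [apply continuity_2d_pt_const|exact I].
  - apply (class_on_S D n _ (fun _ _ => 0) (fun _ _ => 0) HO); auto;
      intros; try apply continuity_2d_pt_const; apply is_derive_cst.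
Qed.

Lemma class_on_plus (D : R * R -> Prop) (n : nat) (f g : R -> R -> R) :
  open D -> class_on D n f -> class_on D n g ->
  class_on D n (fun u v => f u v + g u v).
Proof.
  intros HO; revert f g; induction n as [|n IH]; intros f g Hf Hg.
  - intros u v HD; split; [|exact I].
    apply continuity_2d_pt_plus; [apply (Hf u v HD)|apply (Hg u v HD)].
  - apply (class_on_S D n _ (fun u v => du f u v + du g u v)
             (fun u v => dv f u v + dv g u v) HO).
    + intros u v HD.
      apply continuity_2d_pt_plus; [apply (Hf u v HD)|apply (Hg u v HD)].
    + intros u v HD. eapply is_derive_add; [| |reflexivity];
        eapply class_on_is_du; eassumption.
    + intros u v HD. eapply is_derive_add; [| |reflexivity];
        eapply class_on_is_dv; eassumption.
    + apply IH; intros u v HD; [apply (Hf u v HD)|apply (Hg u v HD)].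
    + apply IH; intros u v HD; [apply (Hf u v HD)|apply (Hg u v HD)].
Qed.

Lemma class_on_mult (D : R * R -> Prop) (n : nat) (f g : R -> R -> R) :
  open D -> class_on D n f -> class_on D n g ->
  class_on D n (fun u v => f u v * g u v).
Proof.
  intros HO; revert f g; induction n as [|n IH]; intros f g Hf Hg.
  - intros u v HD; split; [|exact I].
    apply continuity_2d_pt_mult; [apply (Hf u v HD)|apply (Hg u v HD)].
  - pose proof (class_on_le D (S n) n f (Nat.le_succ_diag_r n) Hf) as Hf'.
    pose proof (class_on_le D (S n) n g (Nat.le_succ_diag_r n) Hg) as Hg'.
    apply (class_on_S D n _ (fun u v => du f u v * g u v + f u v * du g u v)
             (fun u v => dv f u v * g u v + f u v * dv g u v) HO).
    + intros u v HD.
      apply continuity_2d_pt_mult; [apply (Hf u v HD)|apply (Hg u v HD)].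
    + intros u v HD. eapply is_derive_mul; [| |reflexivity];
        eapply class_on_is_du; eassumption.
    + intros u v HD. eapply is_derive_mul; [| |reflexivity];
        eapply class_on_is_dv; eassumption.
    + apply class_on_plus; [exact HO| |]; apply IH; auto;
        intros u v HD; [apply (Hf u v HD)|apply (Hg u v HD)].
    + apply class_on_plus; [exact HO| |]; apply IH; auto;
        intros u v HD; [apply (Hf u v HD)|apply (Hg u v HD)].
Qed.

Lemma class_on_inv (D : R * R -> Prop) (n : nat) (f : R -> R -> R) :
  open D -> (forall u v, D (u, v) -> f u v <> 0) ->
  class_on D n f -> class_on D n (fun u v => / f u v).
Proof.
  intros HO Hnz; induction n as [|n IH]; intros Hf.
  - intros u v HD; split; [|exact I].
    apply continuity_2d_pt_inv; [apply (Hf u v HD)|apply Hnz, HD].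
  - pose proof (IH (class_on_le D (S n) n f (Nat.le_succ_diag_r n) Hf)) as Hi.
    apply (class_on_S D n _ (fun u v => -1 * (du f u v * (/ f u v * / f u v)))
             (fun u v => -1 * (dv f u v * (/ f u v * / f u v))) HO).
    + intros u v HD.
      apply continuity_2d_pt_inv; [apply (Hf u v HD)|apply Hnz, HD].
    + intros u v HD. pose proof (Hnz u v HD).
      replace (-1 * _) with (- du f u v / f u v ^ 2) by (field; assumption).
      apply (is_derive_inv (fun x => f x v) u); [|assumption].
      eapply class_on_is_du; eassumption.
    + intros u v HD. pose proof (Hnz u v HD).
      replace (-1 * _) with (- dv f u v / f u v ^ 2) by (field; assumption).
      apply (is_derive_inv (fun y => f u y) v); [|assumption].
      eapply class_on_is_dv; eassumption.
    + repeat apply class_on_mult; auto; [apply class_on_const, HO|].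
      intros u v HD; apply (Hf u v HD).
    + repeat apply class_on_mult; auto; [apply class_on_const, HO|].
      intros u v HD; apply (Hf u v HD).
Qed.

Lemma class_on_lsum {I : Type} (s : list I) (D : R * R -> Prop) (n : nat)
  (f : I -> R -> R -> R) :
  open D -> (forall i, class_on D n (f i)) ->
  class_on D n (fun u v => lsum s (fun i => f i u v)).
Proof.
  intros HO H; induction s as [|i s IH]; simpl.
  - apply class_on_const, HO.
  - apply (class_on_plus D n (f i)); auto.
Qed.

Lemma smooth_class (D : R * R -> Prop) (f : R -> R -> R) (n : nat) :
  smooth_on D f -> class_on D n f.
Proof. intros H u v HD; apply H, HD. Qed.

Lemma class_smooth (D : R * R -> Prop) (f : R -> R -> R) :
  (forall n, class_on D n f) -> smooth_on D f.
Proof. intros H u v HD n; apply H, HD. Qed.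

Lemma smooth_ext (D : R * R -> Prop) (f g : R -> R -> R) :
  open D -> (forall u v, D (u, v) -> f u v = g u v) ->
  smooth_on D f -> smooth_on D g.
Proof.
  intros HO H Hf. apply class_smooth; intros n.
  apply (class_on_ext D n f g HO H), smooth_class, Hf.
Qed.

Lemma smooth_const (D : R * R -> Prop) (c : R) : open D -> smooth_on D (fun _ _ => c).
Proof. intros HO. apply class_smooth; intros; apply class_on_const, HO. Qed.

Lemma smooth_plus (D : R * R -> Prop) (f g : R -> R -> R) :
  open D -> smooth_on D f -> smooth_on D g -> smooth_on D (fun u v => f u v + g u v).
Proof.
  intros HO Hf Hg. apply class_smooth; intros n.
  apply class_on_plus; auto using smooth_class.
Qed.

Lemma smooth_mult (D : R * R -> Prop) (f g : R -> R -> R) :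
  open D -> smooth_on D f -> smooth_on D g -> smooth_on D (fun u v => f u v * g u v).
Proof.
  intros HO Hf Hg. apply class_smooth; intros n.
  apply class_on_mult; auto using smooth_class.
Qed.

Lemma smooth_opp (D : R * R -> Prop) (f : R -> R -> R) :
  open D -> smooth_on D f -> smooth_on D (fun u v => - f u v).
Proof.
  intros HO Hf. apply (smooth_ext D (fun u v => -1 * f u v)); [exact HO| |].
  - intros; ring.
  - apply smooth_mult; auto using smooth_const.
Qed.

Lemma smooth_minus (D : R * R -> Prop) (f g : R -> R -> R) :
  open D -> smooth_on D f -> smooth_on D g -> smooth_on D (fun u v => f u v - g u v).
Proof.
  intros HO Hf Hg. apply (smooth_plus D f (fun u v => - g u v)); auto using smooth_opp.
Qed.

Lemma smooth_div (D : R * R -> Prop) (f g : R -> R -> R) :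
  open D -> (forall u v, D (u, v) -> g u v <> 0) ->
  smooth_on D f -> smooth_on D g -> smooth_on D (fun u v => f u v / g u v).
Proof.
  intros HO Hnz Hf Hg. apply (smooth_mult D f (fun u v => / g u v)); auto.
  apply class_smooth; intros n. apply class_on_inv; auto using smooth_class.
Qed.

Lemma smooth_du (D : R * R -> Prop) (f : R -> R -> R) :
  smooth_on D f -> smooth_on D (du f).
Proof. intros H u v HD n. apply (H u v HD (S n)). Qed.

Lemma smooth_dv (D : R * R -> Prop) (f : R -> R -> R) :
  smooth_on D f -> smooth_on D (dv f).
Proof. intros H u v HD n. apply (H u v HD (S n)). Qed.

Lemma smooth_is_du (D : R * R -> Prop) (f : R -> R -> R) (u v : R) :
  smooth_on D f -> D (u, v) -> is_derive (fun x => f x v) u (du f u v).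
Proof. intros H HD. apply Derive_correct, (H u v HD 1%nat). Qed.

Lemma smooth_is_dv (D : R * R -> Prop) (f : R -> R -> R) (u v : R) :
  smooth_on D f -> D (u, v) -> is_derive (fun y => f u y) v (dv f u v).
Proof. intros H HD. apply Derive_correct, (H u v HD 1%nat). Qed.

Lemma smooth_sub (D D1 : R * R -> Prop) (f : R -> R -> R) :
  (forall w, D1 w -> D w) -> smooth_on D f -> smooth_on D1 f.
Proof. intros H Hf u v HD; apply Hf, H, HD. Qed.

Lemma smooth_mixed (D : R * R -> Prop) (f : R -> R -> R) (u v : R) :
  open D -> smooth_on D f -> D (u, v) -> du (dv f) u v = dv (du f) u v.
Proof.
  intros HO Hf HD. apply (Schwarz f u v).
  - destruct (open_square D u v HO HD) as [d Hd]. exists d; intros x y Hx Hy.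
    specialize (Hd x y Hx Hy).
    pose proof (Hf x y Hd 2%nat) as (_ & H1 & H2 & H3 & H4).
    repeat split; [apply H1|apply H2|apply H4|apply H3].
  - apply (smooth_du D (dv f) (smooth_dv D f Hf) u v HD 0%nat).
  - apply (smooth_dv D (du f) (smooth_du D f Hf) u v HD 0%nat).
Qed.

(** Continuous solutions of a linear system with smooth coefficients are smooth. *)
Lemma pfaffian_smooth {I : Type} (s : list I) (P Q : I -> I -> R -> R -> R)
  (D : R * R -> Prop) (A : I -> R -> R -> R) :
  open D ->
  (forall i j, smooth_on D (P i j)) -> (forall i j, smooth_on D (Q i j)) ->
  (forall i, cont2 (A i)) ->
  (forall i u v, D (u, v) ->
     is_derive (fun x => A i x v) u (lsum s (fun j => P i j u v * A j u v)) /\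
     is_derive (fun y => A i u y) v (lsum s (fun j => Q i j u v * A j u v))) ->
  forall i, smooth_on D (A i).
Proof.
  intros HO HP HQ HA Hd i. apply class_smooth; intros n; revert i.
  induction n as [|n IH]; intros i.
  - intros u v HD; split; [apply HA|exact Logic.I].
  - apply (class_on_S D n (A i) (fun u v => lsum s (fun j => P i j u v * A j u v))
             (fun u v => lsum s (fun j => Q i j u v * A j u v)) HO).
    + intros; apply HA.
    + intros; apply Hd; assumption.
    + intros; apply Hd; assumption.
    + apply (class_on_lsum s D n (fun j u v => P i j u v * A j u v) HO).
      intros j; apply class_on_mult; auto using smooth_class.
    + apply (class_on_lsum s D n (fun j u v => Q i j u v * A j u v) HO).
      intros j; apply class_on_mult; auto using smooth_class.
Qed.

(** * Connected open sets *)

(** The open square of centre [(u0, v0)] and half-side [d]. *)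
Definition square (u0 v0 d : R) (w : R * R) : Prop :=
  Rabs (fst w - u0) < d /\ Rabs (snd w - v0) < d.

Lemma square_open (u0 v0 d : R) : open (square u0 v0 d).
Proof.
  intros [u v] [Hu Hv]; simpl in Hu, Hv.
  destruct (locally_dist_lt u0 d u Hu) as [e1 H1].
  destruct (locally_dist_lt v0 d v Hv) as [e2 H2].
  apply (locally_2d_locally (fun x y => square u0 v0 d (x, y)) u v).
  exists (mkposreal _ (Rmin_stable_in_posreal e1 e2)); simpl.
  intros x y Hx Hy; split; simpl.
  - apply H1. eapply Rlt_le_trans; [exact Hx|apply Rmin_l].
  - apply H2. eapply Rlt_le_trans; [exact Hy|apply Rmin_r].
Qed.

Lemma square_center (u0 v0 d : R) : 0 < d -> square u0 v0 d (u0, v0).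
Proof. intros Hd; split; simpl; rewrite Rminus_diag, Rabs_R0; exact Hd. Qed.

Lemma const_on_square (f : R -> R -> R) (u0 v0 d : R) :
  (forall u v, square u0 v0 d (u, v) ->
     is_derive (fun x => f x v) u 0 /\ is_derive (fun y => f u y) v 0) ->
  forall u v, square u0 v0 d (u, v) -> f u v = f u0 v0.
Proof.
  intros H u v [Hu Hv]; simpl in Hu, Hv.
  assert (E0 : Rabs (u0 - u0) < d).
  { rewrite Rminus_diag, Rabs_R0. eapply Rle_lt_trans; [apply Rabs_pos|exact Hu]. }
  assert (H1 : Rabs (f u v - f u0 v) <= 0 * Rabs (u - u0)).
  { apply (bounded_variation (fun x => f x v) (fun _ => 0)).
    intros x Hx; split; [|rewrite Rabs_R0; lra].
    apply H; split; simpl; lra. }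
  assert (H2 : Rabs (f u0 v - f u0 v0) <= 0 * Rabs (v - v0)).
  { apply (bounded_variation (fun y => f u0 y) (fun _ => 0)).
    intros y Hy; split; [|rewrite Rabs_R0; lra].
    apply H; split; simpl; lra. }
  rewrite Rmult_0_l in H1, H2.
  pose proof (Rabs_pos (f u v - f u0 v)). pose proof (Rabs_pos (f u0 v - f u0 v0)).
  assert (E1 : f u v - f u0 v = 0) by (apply Rabs_eq_0; lra).
  assert (E2 : f u0 v - f u0 v0 = 0) by (apply Rabs_eq_0; lra). lra.
Qed.

(** The level sets of a function with zero partial derivatives are open. *)
Lemma const_on_connected (D : R * R -> Prop) (f : R -> R -> R) :
  open D -> connected_set D ->
  (forall u v, D (u, v) ->
     is_derive (fun x => f x v) u 0 /\ is_derive (fun y => f u y) v 0) ->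
  forall u v u' v', D (u, v) -> D (u', v') -> f u v = f u' v'.
Proof.
  intros HO HC H u v u' v' HD HD'. apply NNPP; intros Hne.
  assert (Hloc : forall x y, D (x, y) -> exists d : posreal,
            forall x' y', Rabs (x' - x) < d -> Rabs (y' - y) < d ->
              D (x', y') /\ f x' y' = f x y).
  { intros x y Hxy. destruct (open_square D x y HO Hxy) as [d Hd].
    exists d; intros x' y' Hx Hy; split; [apply Hd; assumption|].
    apply (const_on_square f x y d); [|split; assumption].
    intros a b [Ha Hb]; apply H, Hd; assumption. }
  assert (Hop : forall S : R -> Prop,
            open (fun w : R * R => D (fst w, snd w) /\ S (f (fst w) (snd w)))).
  { intros S [x y] [Hw Hs]; simpl in Hs.
    apply (locally_2d_locally (fun x y => D (x, y) /\ S (f x y)) x y).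
    destruct (Hloc x y Hw) as [d Hd]. exists d; intros x' y' Hx Hy.
    destruct (Hd x' y' Hx Hy) as [h1 h2]; rewrite h2; auto. }
  destruct (HC _ _ (Hop (fun r => r = f u v)) (Hop (fun r => r <> f u v)))
    as [w [_ [[_ h1] [_ h2]]]].
  - intros [x y] Hw; simpl. destruct (Req_dec (f x y) (f u v)); auto.
  - exists (u, v); auto.
  - exists (u', v'); auto.
  - apply h2, h1.
Qed.

(** A separation of the square would have a locally constant indicator function. *)
Lemma square_connected (u0 v0 d : R) : connected_set (square u0 v0 d).
Proof.
  intros U V HU HV Hcov [[a b] [Sa Ua]] [[a' b'] [Sb Vb]].
  apply NNPP; intros Hno.
  pose (f := fun x y => if excluded_middle_informative (U (x, y)) then 1 else 0).
  assert (Hloc : forall x y, square u0 v0 d (x, y) ->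
            locally_2d (fun x' y' => f x' y' = f x y) x y).
  { intros x y Hxy. unfold f at 2.
    destruct (excluded_middle_informative (U (x, y))) as [Hu|Hu].
    - destruct (open_square U x y HU Hu) as [e He].
      exists e; intros x' y' h1 h2. unfold f.
      destruct excluded_middle_informative; [reflexivity|].
      exfalso; auto.
    - assert (Hv : V (x, y)) by (destruct (Hcov _ Hxy); tauto).
      destruct (open_square V x y HV Hv) as [e He].
      destruct (open_square _ x y (square_open u0 v0 d) Hxy) as [e' He'].
      exists (mkposreal _ (Rmin_stable_in_posreal e e')); simpl.
      intros x' y' h1 h2. unfold f.
      destruct excluded_middle_informative as [Hu'|]; [|reflexivity].
      exfalso; apply Hno. exists (x', y'); split; [|split; [exact Hu'|]].
      + apply He'; (eapply Rlt_le_trans; [eassumption|apply Rmin_r]).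
      + apply He; (eapply Rlt_le_trans; [eassumption|apply Rmin_l]). }
  assert (Hd : forall u v, square u0 v0 d (u, v) ->
     is_derive (fun x => f x v) u 0 /\ is_derive (fun y => f u y) v 0).
  { intros u v Huv. specialize (Hloc u v Huv). split.
    - apply (is_derive_ext_loc (fun _ => f u v)); [|apply is_derive_cst].
      apply locally_2d_1d_const_y in Hloc.
      eapply filter_imp; [|exact Hloc]. intros; symmetry; assumption.
    - apply (is_derive_ext_loc (fun _ => f u v)); [|apply is_derive_cst].
      apply locally_2d_1d_const_x in Hloc.
      eapply filter_imp; [|exact Hloc]. intros; symmetry; assumption. }
  assert (E : f a b = f a' b').
  { rewrite (const_on_square f u0 v0 d Hd a b Sa).
    symmetry; apply (const_on_square f u0 v0 d Hd a' b' Sb). }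
  unfold f in E.
  destruct (excluded_middle_informative (U (a, b))); [|tauto].
  destruct (excluded_middle_informative (U (a', b'))); [|lra].
  apply Hno; exists (a', b'); auto.
Qed.

(** * Linear algebra in Minkowski space *)

(** The vector [a X + b Y + c l]. *)
Definition comb (a : R) (X : vec) (b : R) (Y : vec) (c : R) (l : vec) : vec :=
  (a * crd1 X + b * crd1 Y + c * crd1 l,
   a * crd2 X + b * crd2 Y + c * crd2 l,
   a * crd3 X + b * crd3 Y + c * crd3 l).

Lemma vec_eq (a b : vec) :
  crd1 a = crd1 b -> crd2 a = crd2 b -> crd3 a = crd3 b -> a = b.
Proof.
  destruct a as [[a1 a2] a3]; destruct b as [[b1 b2] b3].
  unfold crd1, crd2, crd3; simpl; intros -> -> ->; reflexivity.
Qed.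

Lemma mink_sym (a b : vec) : mink a b = mink b a.
Proof. unfold mink; ring. Qed.

Lemma mink_comb_l (a b c : R) (X Y l w : vec) :
  mink (comb a X b Y c l) w = a * mink X w + b * mink Y w + c * mink l w.
Proof. unfold mink, comb, crd1, crd2, crd3; simpl; ring. Qed.

Lemma mink_comb_r (a b c : R) (X Y l w : vec) :
  mink w (comb a X b Y c l) = a * mink w X + b * mink w Y + c * mink w l.
Proof. unfold mink, comb, crd1, crd2, crd3; simpl; ring. Qed.

Lemma mink_scal_l (c : R) (a b : vec) : mink (scal c a) b = c * mink a b.
Proof.
  destruct a as [[a1 a2] a3]. unfold mink, crd1, crd2, crd3; simpl.
  unfold scal; simpl; unfold mult; simpl. ring.
Qed.

Lemma mink_scal_r (c : R) (a b : vec) : mink a (scal c b) = c * mink a b.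
Proof. rewrite mink_sym, mink_scal_l, mink_sym; reflexivity. Qed.

Lemma crd_scal (c : R) (a : vec) :
  crd1 (scal c a) = c * crd1 a /\ crd2 (scal c a) = c * crd2 a /\
  crd3 (scal c a) = c * crd3 a.
Proof. destruct a as [[a1 a2] a3]. repeat split. Qed.

(** The Gram determinant of three vectors is minus the square of their determinant. *)
Lemma gram_det3 (X Y l : vec) :
  mink X X * (mink Y Y * mink l l - mink Y l * mink Y l)
  - mink X Y * (mink X Y * mink l l - mink Y l * mink X l)
  + mink X l * (mink X Y * mink Y l - mink Y Y * mink X l)
  = - (det3 X Y l * det3 X Y l).
Proof. unfold mink, det3; ring. Qed.

Lemma mink_nondegenerate (X Y l v w : vec) :
  det3 X Y l <> 0 ->
  mink v X = mink w X -> mink v Y = mink w Y -> mink v l = mink w l -> v = w.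
Proof.
  intros Hd HX HY Hl.
  assert (C : forall t, det3 X Y l * t = 0 -> t = 0).
  { intros t Ht. apply Rmult_integral in Ht; tauto. }
  set (x := mink v X - mink w X). set (y := mink v Y - mink w Y).
  set (z := mink v l - mink w l).
  assert (Ex : x = 0) by (unfold x; lra). assert (Ey : y = 0) by (unfold y; lra).
  assert (Ez : z = 0) by (unfold z; lra).
  (* Cramer's rule for the difference of the two vectors. *)
  apply vec_eq; apply Rminus_diag_uniq, C.
  - transitivity (x * (crd2 Y * crd3 l - crd3 Y * crd2 l)
      - y * (crd2 X * crd3 l - crd3 X * crd2 l)
      + z * (crd2 X * crd3 Y - crd3 X * crd2 Y)).
    + unfold x, y, z, mink, det3; ring.
    + rewrite Ex, Ey, Ez; ring.
  - transitivity (- x * (crd1 Y * crd3 l - crd3 Y * crd1 l)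
      + y * (crd1 X * crd3 l - crd3 X * crd1 l)
      - z * (crd1 X * crd3 Y - crd3 X * crd1 Y)).
    + unfold x, y, z, mink, det3; ring.
    + rewrite Ex, Ey, Ez; ring.
  - transitivity (- x * (crd1 Y * crd2 l - crd2 Y * crd1 l)
      + y * (crd1 X * crd2 l - crd2 X * crd1 l)
      - z * (crd1 X * crd2 Y - crd2 X * crd1 Y)).
    + unfold x, y, z, mink, det3; ring.
    + rewrite Ex, Ey, Ez; ring.
Qed.

(** Orthonormality of a triple of signature (+, +, -), of either orientation. *)
Definition orthonormal (X Y l : vec) : Prop :=
  mink X X = 1 /\ mink Y Y = 1 /\ mink l l = -1 /\
  mink X Y = 0 /\ mink X l = 0 /\ mink Y l = 0.

Lemma orthonormal_det3 (X Y l : vec) :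
  orthonormal X Y l -> det3 X Y l * det3 X Y l = 1.
Proof.
  intros (h1 & h2 & h3 & h4 & h5 & h6). pose proof (gram_det3 X Y l) as H.
  rewrite h1, h2, h3, h4, h5, h6 in H. lra.
Qed.

Lemma orthonormal_det3_neq0 (X Y l : vec) : orthonormal X Y l -> det3 X Y l <> 0.
Proof. intros H E. apply orthonormal_det3 in H. rewrite E in H. lra. Qed.

Lemma positive_det3_1 (X Y l : vec) :
  orthonormal X Y l -> 0 < det3 X Y l -> det3 X Y l = 1.
Proof.
  intros H Hp. apply orthonormal_det3 in H.
  assert ((det3 X Y l - 1) * (det3 X Y l + 1) = 0) as E by lra.
  apply Rmult_integral in E; lra.
Qed.

Lemma orthonormal_expansion (X Y l w : vec) :
  orthonormal X Y l -> w = comb (mink w X) X (mink w Y) Y (- mink w l) l.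
Proof.
  intros H. apply (mink_nondegenerate X Y l); [apply orthonormal_det3_neq0, H|..];
    rewrite mink_comb_l; destruct H as (h1 & h2 & h3 & h4 & h5 & h6).
  - rewrite h1, (mink_sym Y X), (mink_sym l X), h4, h5; ring.
  - rewrite h2, (mink_sym l Y), h4, h6; ring.
  - rewrite h3, h5, h6; ring.
Qed.

(** If the rows of a matrix are orthonormal, then so are its columns. *)
Lemma orthonormal_transpose (X Y l : vec) :
  orthonormal X Y l ->
  orthonormal (crd1 X, crd1 Y, crd1 l) (crd2 X, crd2 Y, crd2 l)
              (crd3 X, crd3 Y, crd3 l).
Proof.
  intros H.
  pose proof (orthonormal_expansion X Y l (1, 0, 0) H) as E1.
  pose proof (orthonormal_expansion X Y l (0, 1, 0) H) as E2.
  pose proof (orthonormal_expansion X Y l (0, 0, 1) H) as E3.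
  unfold comb, mink, crd1, crd2, crd3 in *; simpl in *.
  injection E1; injection E2; injection E3; intros.
  unfold orthonormal, mink, crd1, crd2, crd3; simpl. repeat split; lra.
Qed.

Lemma positive_frame_orthonormal (X Y l : vec) :
  positive_orthonormal_frame X Y l -> orthonormal X Y l /\ 0 < det3 X Y l.
Proof. intros (h1 & h2 & h3 & h4 & h5 & h6 & h7). repeat split; assumption. Qed.

(** The linear map sending [X], [Y], [l] to [X1], [Y1], [l1], when [X], [Y], [l] are
    orthonormal. *)
Definition frame_map (X Y l X1 Y1 l1 : vec) (w : vec) : vec :=
  comb (mink w X) X1 (mink w Y) Y1 (- mink w l) l1.

Lemma is_linear_crd :
  is_linear (fun w : vec => crd1 w) /\ is_linear (fun w : vec => crd2 w) /\
  is_linear (fun w : vec => crd3 w).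
Proof.
  repeat split.
  all: try (apply (is_linear_comp (fun w : vec => fst w));
            [apply is_linear_fst|]; first [apply is_linear_fst|apply is_linear_snd]).
  all: apply is_linear_snd.
Qed.

Lemma is_linear_form (a b c : R) :
  is_linear (fun w : vec => a * crd1 w + b * crd2 w + c * crd3 w).
Proof.
  destruct is_linear_crd as (h1 & h2 & h3).
  assert (Hs : forall (k : R) (f : vec -> R), is_linear f -> is_linear (fun w => k * f w)).
  { intros k f Hf. apply (is_linear_comp f (fun x : R => scal k x) Hf).
    apply (@is_linear_scal_r R_AbsRing R_NormedModule k). exact Rmult_comm. }
  assert (Ha : forall f g : vec -> R, is_linear f -> is_linear g ->
            is_linear (fun w => f w + g w)).
  { intros f g Hf Hg.
    apply (is_linear_comp (fun w => (f w, g w)) (fun x : R * R => plus (fst x) (snd x))).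
    - apply is_linear_prod; assumption.
    - apply (@is_linear_plus R_AbsRing R_NormedModule). }
  auto.
Qed.

Lemma frame_map_linear (X Y l X1 Y1 l1 : vec) :
  is_linear (frame_map X Y l X1 Y1 l1).
Proof.
  assert (H : forall k1 k2 k3 : R, is_linear (fun w : vec =>
            mink w X * k1 + mink w Y * k2 + - mink w l * k3)).
  { intros k1 k2 k3.
    apply (is_linear_ext (fun w : vec =>
      (crd1 X * k1 + crd1 Y * k2 - crd1 l * k3) * crd1 w +
      (crd2 X * k1 + crd2 Y * k2 - crd2 l * k3) * crd2 w +
      (- crd3 X * k1 - crd3 Y * k2 + crd3 l * k3) * crd3 w)).
    - intros w; unfold mink. simpl; ring.
    - apply is_linear_form. }
  unfold frame_map, comb.
  apply (is_linear_prod (fun w : vec =>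
    (mink w X * crd1 X1 + mink w Y * crd1 Y1 + - mink w l * crd1 l1,
     mink w X * crd2 X1 + mink w Y * crd2 Y1 + - mink w l * crd2 l1))); [|apply H].
  apply is_linear_prod; apply H.
Qed.

Lemma frame_map_mink (X Y l X1 Y1 l1 x y : vec) :
  orthonormal X Y l -> orthonormal X1 Y1 l1 ->
  mink (frame_map X Y l X1 Y1 l1 x) (frame_map X Y l X1 Y1 l1 y) = mink x y.
Proof.
  intros H (h1 & h2 & h3 & h4 & h5 & h6). unfold frame_map.
  rewrite !mink_comb_l, !mink_comb_r, (mink_sym Y1 X1), (mink_sym l1 X1),
    (mink_sym l1 Y1), h1, h2, h3, h4, h5, h6.
  transitivity (mink x (comb (mink y X) X (mink y Y) Y (- mink y l) l)).
  - rewrite mink_comb_r. ring.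
  - rewrite <- (orthonormal_expansion X Y l y H); reflexivity.
Qed.

Lemma det3_comb (X Y l : vec) (a1 b1 c1 a2 b2 c2 a3 b3 c3 : R) :
  det3 (comb a1 X b1 Y c1 l) (comb a2 X b2 Y c2 l) (comb a3 X b3 Y c3 l)
  = det3 (a1, b1, c1) (a2, b2, c2) (a3, b3, c3) * det3 X Y l.
Proof. unfold det3, comb, crd1, crd2, crd3; simpl; ring. Qed.

Lemma frame_map_det3 (X Y l X1 Y1 l1 x y w : vec) :
  orthonormal X Y l -> 0 < det3 X Y l -> orthonormal X1 Y1 l1 -> 0 < det3 X1 Y1 l1 ->
  det3 (frame_map X Y l X1 Y1 l1 x) (frame_map X Y l X1 Y1 l1 y)
       (frame_map X Y l X1 Y1 l1 w) = det3 x y w.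
Proof.
  intros H Hp H1 Hp1. unfold frame_map. rewrite det3_comb.
  transitivity (det3 (comb (mink x X) X (mink x Y) Y (- mink x l) l)
                     (comb (mink y X) X (mink y Y) Y (- mink y l) l)
                     (comb (mink w X) X (mink w Y) Y (- mink w l) l)).
  - rewrite det3_comb, (positive_det3_1 X Y l), (positive_det3_1 X1 Y1 l1)
      by assumption.
    reflexivity.
  - rewrite <- !(orthonormal_expansion X Y l _ H); reflexivity.
Qed.

(** * Vector-valued functions *)

(** [w'] is the derivative of the curve [w] at [x], coordinate by coordinate. *)
Definition vderiv (w : R -> vec) (x : R) (w' : vec) : Prop :=
  is_derive (fun t => crd1 (w t)) x (crd1 w') /\
  is_derive (fun t => crd2 (w t)) x (crd2 w') /\
  is_derive (fun t => crd3 (w t)) x (crd3 w').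

(** Splits conjunctions only: [is_derive] is itself a conjunction up to unfolding. *)
Ltac split_ands :=
  unfold vderiv, vsmooth_on, orthonormal; repeat match goal with |- _ /\ _ => split end.

Lemma vderiv_mink (a b : R -> vec) (x c : R) (a' b' : vec) :
  vderiv a x a' -> vderiv b x b' -> mink a' (b x) + mink (a x) b' = c ->
  is_derive (fun t => mink (a t) (b t)) x c.
Proof.
  intros (a1 & a2 & a3) (b1 & b2 & b3) <-. unfold mink at 1.
  eapply is_derive_sub; [eapply is_derive_add|..];
    try (eapply is_derive_mul; [eassumption|eassumption|reflexivity]);
    [reflexivity|]. unfold mink; ring.
Qed.

Lemma vderiv_scal (f : R -> R) (w : R -> vec) (x f' : R) (w' : vec) :
  is_derive f x f' -> vderiv w x w' ->
  vderiv (fun t => scal (f t) (w t)) x (plus (scal f' (w x)) (scal (f x) w')).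
Proof.
  intros Hf (h1 & h2 & h3). split_ands.
  - apply (is_derive_ext (fun t => f t * crd1 (w t))); [intros; symmetry; apply crd_scal|].
    eapply is_derive_mul; [eassumption|eassumption|reflexivity].
  - apply (is_derive_ext (fun t => f t * crd2 (w t))); [intros; symmetry; apply crd_scal|].
    eapply is_derive_mul; [eassumption|eassumption|reflexivity].
  - apply (is_derive_ext (fun t => f t * crd3 (w t))); [intros; symmetry; apply crd_scal|].
    eapply is_derive_mul; [eassumption|eassumption|reflexivity].
Qed.

Lemma vderiv_ext_loc (w1 w2 : R -> vec) (x : R) (w' : vec) :
  locally x (fun t => w1 t = w2 t) -> vderiv w1 x w' -> vderiv w2 x w'.
Proof.
  intros He (h1 & h2 & h3).
  split_ands; (eapply is_derive_ext_loc; [|eassumption]);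
    (eapply filter_imp; [|exact He]); intros t ->; reflexivity.
Qed.

Lemma vderiv_vdu (z : R -> R -> vec) (u v : R) (w : vec) :
  vderiv (fun x => z x v) u w -> vdu z u v = w.
Proof.
  intros (h1 & h2 & h3). apply is_derive_unique in h1, h2, h3.
  apply vec_eq; assumption.
Qed.

Lemma vderiv_vdv (z : R -> R -> vec) (u v : R) (w : vec) :
  vderiv (fun y => z u y) v w -> vdv z u v = w.
Proof.
  intros (h1 & h2 & h3). apply is_derive_unique in h1, h2, h3.
  apply vec_eq; assumption.
Qed.

Lemma vsmooth_is_vdu (D : R * R -> Prop) (z : R -> R -> vec) (u v : R) :
  vsmooth_on D z -> D (u, v) -> vderiv (fun x => z x v) u (vdu z u v).
Proof.
  intros (h1 & h2 & h3) HD.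
  split_ands; [apply (smooth_is_du D (fun s t => crd1 (z s t)))
                |apply (smooth_is_du D (fun s t => crd2 (z s t)))
                |apply (smooth_is_du D (fun s t => crd3 (z s t)))]; assumption.
Qed.

Lemma vsmooth_is_vdv (D : R * R -> Prop) (z : R -> R -> vec) (u v : R) :
  vsmooth_on D z -> D (u, v) -> vderiv (fun y => z u y) v (vdv z u v).
Proof.
  intros (h1 & h2 & h3) HD.
  split_ands; [apply (smooth_is_dv D (fun s t => crd1 (z s t)))
                |apply (smooth_is_dv D (fun s t => crd2 (z s t)))
                |apply (smooth_is_dv D (fun s t => crd3 (z s t)))]; assumption.
Qed.

Lemma vsmooth_vdu (D : R * R -> Prop) (z : R -> R -> vec) :
  vsmooth_on D z -> vsmooth_on D (vdu z).
Proof.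
  intros (h1 & h2 & h3). apply smooth_du in h1, h2, h3.
  split_ands; assumption.
Qed.

Lemma vsmooth_vdv (D : R * R -> Prop) (z : R -> R -> vec) :
  vsmooth_on D z -> vsmooth_on D (vdv z).
Proof.
  intros (h1 & h2 & h3). apply smooth_dv in h1, h2, h3.
  split_ands; assumption.
Qed.

Lemma vsmooth_mixed (D : R * R -> Prop) (z : R -> R -> vec) (u v : R) :
  open D -> vsmooth_on D z -> D (u, v) -> vdu (vdv z) u v = vdv (vdu z) u v.
Proof.
  intros HO (h1 & h2 & h3) HD.
  apply vec_eq; [apply (smooth_mixed D (fun s t => crd1 (z s t)))
                |apply (smooth_mixed D (fun s t => crd2 (z s t)))
                |apply (smooth_mixed D (fun s t => crd3 (z s t)))]; assumption.
Qed.

(** * The frame equations *)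

(** The equations of a principal frame, with [a], [c] the geodesic and [b], [d] the
    normal curvatures multiplied by the speed along each parameter line. *)
Definition frame_eqs (D : R * R -> Prop) (a b c d : R -> R -> R)
  (X Y l : R -> R -> vec) : Prop :=
  forall u v, D (u, v) ->
    vderiv (fun x => X x v) u (comb 0 (X u v) (a u v) (Y u v) (- b u v) (l u v)) /\
    vderiv (fun x => Y x v) u (comb (- a u v) (X u v) 0 (Y u v) 0 (l u v)) /\
    vderiv (fun x => l x v) u (comb (- b u v) (X u v) 0 (Y u v) 0 (l u v)) /\
    vderiv (fun y => X u y) v (comb 0 (X u v) (c u v) (Y u v) 0 (l u v)) /\
    vderiv (fun y => Y u y) v (comb (- c u v) (X u v) 0 (Y u v) (- d u v) (l u v)) /\
    vderiv (fun y => l u y) v (comb 0 (X u v) (- d u v) (Y u v) 0 (l u v)).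

(** One coordinate of the frame equations. *)
Definition frame_eqs1 (D : R * R -> Prop) (a b c d : R -> R -> R)
  (x y l : R -> R -> R) : Prop :=
  forall u v, D (u, v) ->
    is_derive (fun t => x t v) u (a u v * y u v - b u v * l u v) /\
    is_derive (fun t => y t v) u (- a u v * x u v) /\
    is_derive (fun t => l t v) u (- b u v * x u v) /\
    is_derive (fun t => x u t) v (c u v * y u v) /\
    is_derive (fun t => y u t) v (- c u v * x u v - d u v * l u v) /\
    is_derive (fun t => l u t) v (- d u v * y u v).

Lemma frame_eqs_coord (D : R * R -> Prop) (a b c d : R -> R -> R)
  (X Y l : R -> R -> vec) :
  frame_eqs D a b c d X Y l <->
  frame_eqs1 D a b c d (fun u v => crd1 (X u v)) (fun u v => crd1 (Y u v))
    (fun u v => crd1 (l u v)) /\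
  frame_eqs1 D a b c d (fun u v => crd2 (X u v)) (fun u v => crd2 (Y u v))
    (fun u v => crd2 (l u v)) /\
  frame_eqs1 D a b c d (fun u v => crd3 (X u v)) (fun u v => crd3 (Y u v))
    (fun u v => crd3 (l u v)).
Proof.
  split.
  - intros H.
    split; [|split]; intros u v HD; destruct (H u v HD) as
      ((x1 & x2 & x3) & (y1 & y2 & y3) & (l1 & l2 & l3) &
       (x1' & x2' & x3') & (y1' & y2' & y3') & (l1' & l2' & l3'));
    split_ands; (eapply is_derive_val; [eassumption|]);
    unfold comb, crd1, crd2, crd3; simpl; ring.
  - intros (H1 & H2 & H3) u v HD.
    destruct (H1 u v HD) as (x1 & y1 & l1 & x1' & y1' & l1').
    destruct (H2 u v HD) as (x2 & y2 & l2 & x2' & y2' & l2').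
    destruct (H3 u v HD) as (x3 & y3 & l3 & x3' & y3' & l3').
    split_ands; (eapply is_derive_val; [eassumption|]);
    unfold comb, crd1, crd2, crd3; simpl; ring.
Qed.

(** The coefficient matrices of the frame equations are skew for the metric, so that
    the pairing of two solutions is constant. *)
Lemma frame_pairing_const (D : R * R -> Prop) (a b c d x y l x' y' l' : R -> R -> R) :
  open D -> connected_set D ->
  frame_eqs1 D a b c d x y l -> frame_eqs1 D a b c d x' y' l' ->
  forall u v u1 v1, D (u, v) -> D (u1, v1) ->
    x u v * x' u v + y u v * y' u v - l u v * l' u v
    = x u1 v1 * x' u1 v1 + y u1 v1 * y' u1 v1 - l u1 v1 * l' u1 v1.
Proof.
  intros HO HC H H'.
  apply (const_on_connected D
    (fun u v => x u v * x' u v + y u v * y' u v - l u v * l' u v) HO HC).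
  intros u v HD.
  destruct (H u v HD) as (h1 & h2 & h3 & h4 & h5 & h6).
  destruct (H' u v HD) as (k1 & k2 & k3 & k4 & k5 & k6).
  split.
  - eapply is_derive_sub; [eapply is_derive_add|..];
      try (eapply is_derive_mul; [eassumption|eassumption|reflexivity]);
      [reflexivity|ring].
  - eapply is_derive_sub; [eapply is_derive_add|..];
      try (eapply is_derive_mul; [eassumption|eassumption|reflexivity]);
      [reflexivity|ring].
Qed.

(** A solution of the frame equations that is orthonormal at one point is so
    everywhere: the products of its coordinate columns are constant. *)
Lemma frame_orthonormal (D : R * R -> Prop) (a b c d : R -> R -> R)
  (X Y l : R -> R -> vec) (u0 v0 : R) :
  open D -> connected_set D -> frame_eqs D a b c d X Y l -> D (u0, v0) ->
  orthonormal (X u0 v0) (Y u0 v0) (l u0 v0) ->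
  forall u v, D (u, v) -> orthonormal (X u v) (Y u v) (l u v).
Proof.
  intros HO HC HF H0 Ho u v HD.
  apply frame_eqs_coord in HF. destruct HF as (F1 & F2 & F3).
  apply orthonormal_transpose in Ho.
  assert (H : orthonormal (crd1 (X u v), crd1 (Y u v), crd1 (l u v))
                          (crd2 (X u v), crd2 (Y u v), crd2 (l u v))
                          (crd3 (X u v), crd3 (Y u v), crd3 (l u v))).
  { destruct Ho as (h1 & h2 & h3 & h4 & h5 & h6).
    pose proof (frame_pairing_const D a b c d _ _ _ _ _ _ HO HC F1 F1 u v u0 v0 HD H0).
    pose proof (frame_pairing_const D a b c d _ _ _ _ _ _ HO HC F2 F2 u v u0 v0 HD H0).
    pose proof (frame_pairing_const D a b c d _ _ _ _ _ _ HO HC F3 F3 u v u0 v0 HD H0).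
    pose proof (frame_pairing_const D a b c d _ _ _ _ _ _ HO HC F1 F2 u v u0 v0 HD H0).
    pose proof (frame_pairing_const D a b c d _ _ _ _ _ _ HO HC F1 F3 u v u0 v0 HD H0).
    pose proof (frame_pairing_const D a b c d _ _ _ _ _ _ HO HC F2 F3 u v u0 v0 HD H0).
    unfold mink in *; cbn [crd1 crd2 crd3 fst snd] in *.
    unfold crd1, crd2, crd3 in *; simpl in *.
    split_ands; unfold mink, crd1, crd2, crd3; simpl; lra. }
  apply orthonormal_transpose in H.
  destruct (X u v) as [[x1 x2] x3]; destruct (Y u v) as [[y1 y2] y3];
    destruct (l u v) as [[l1 l2] l3]. exact H.
Qed.

Lemma frame_det3 (D : R * R -> Prop) (a b c d : R -> R -> R)
  (X Y l : R -> R -> vec) :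
  open D -> connected_set D -> frame_eqs D a b c d X Y l ->
  forall u v u1 v1, D (u, v) -> D (u1, v1) ->
    det3 (X u v) (Y u v) (l u v) = det3 (X u1 v1) (Y u1 v1) (l u1 v1).
Proof.
  intros HO HC HF.
  apply (const_on_connected D (fun u v => det3 (X u v) (Y u v) (l u v)) HO HC).
  intros u v HD. unfold det3. destruct (HF u v HD) as
      ((x1 & x2 & x3) & (y1 & y2 & y3) & (l1 & l2 & l3) &
       (x1' & x2' & x3') & (y1' & y2' & y3') & (l1' & l2' & l3')).
  split.
  - eapply is_derive_add; [eapply is_derive_sub|..];
      try (eapply is_derive_mul; [eassumption| |reflexivity];
           eapply is_derive_sub; [| |reflexivity];
           (eapply is_derive_mul; [eassumption|eassumption|reflexivity]));
      [reflexivity|]. unfold comb, crd1, crd2, crd3; simpl; ring.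
  - eapply is_derive_add; [eapply is_derive_sub|..];
      try (eapply is_derive_mul; [eassumption| |reflexivity];
           eapply is_derive_sub; [| |reflexivity];
           (eapply is_derive_mul; [eassumption|eassumption|reflexivity]));
      [reflexivity|]. unfold comb, crd1, crd2, crd3; simpl; ring.
Qed.

(** * From the invariants to the frame equations *)

(** The integrability conditions of the frame equations, for the speeds [p], [q] of the
    parameter lines. *)
Definition integrable_invariants (D : R * R -> Prop)
  (p q nu1 nu2 gam1 gam2 : R -> R -> R) : Prop :=
  smooth_on D p /\ smooth_on D q /\
  forall u v, D (u, v) ->
    0 < p u v /\ 0 < q u v /\
    dv nu1 u v = gam1 u v * (nu1 u v - nu2 u v) * q u v /\
    du nu2 u v = gam2 u v * (nu1 u v - nu2 u v) * p u v /\
    dv p u v = - (gam1 u v * p u v * q u v) /\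
    du q u v = gam2 u v * p u v * q u v /\
    dv gam1 u v * p u v + gam1 u v * dv p u v + nu1 u v * p u v * (nu2 u v * q u v)
      = du gam2 u v * q u v + gam2 u v * du q u v.

(** The Codazzi equations determine the speeds, [cond21] then gives the
    derivatives of the speeds, and [cond22] is the Gauss equation. *)
Lemma invariants_integrable (D : R * R -> Prop) (nu1 nu2 gam1 gam2 : R -> R -> R)
  (D_open : open D)
  (nu1_smooth : smooth_on D nu1) (nu2_smooth : smooth_on D nu2)
  (gam1_smooth : smooth_on D gam1) (gam2_smooth : smooth_on D gam2)
  (nu_pos : forall u v : R, D (u, v) -> 0 < nu1 u v - nu2 u v)
  (cond1 : forall u v : R, D (u, v) ->
     0 < gam1 u v * dv nu1 u v /\ 0 < gam2 u v * du nu2 u v)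
  (cond21 : forall u v : R, D (u, v) ->
     du (fun s t => ln (dv nu1 s t / gam1 s t)) u v
       = du nu1 u v / (nu1 u v - nu2 u v) /\
     dv (fun s t => ln (du nu2 s t / gam2 s t)) u v
       = - (dv nu2 u v / (nu1 u v - nu2 u v)))
  (cond22 : forall u v : R, D (u, v) ->
     (nu1 u v - nu2 u v) / 2 *
       (du (fun s t => gam2 s t ^ 2) u v / du nu2 u v
        - dv (fun s t => gam1 s t ^ 2) u v / dv nu1 u v)
     + gam1 u v ^ 2 + gam2 u v ^ 2 = nu1 u v * nu2 u v) :
  integrable_invariants D
    (fun u v => du nu2 u v / gam2 u v / (nu1 u v - nu2 u v))
    (fun u v => dv nu1 u v / gam1 u v / (nu1 u v - nu2 u v))
    nu1 nu2 gam1 gam2.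
Proof.
  assert (Hnz : forall u v, D (u, v) -> gam1 u v <> 0 /\ gam2 u v <> 0 /\
            dv nu1 u v <> 0 /\ du nu2 u v <> 0).
  { intros u v HD. destruct (cond1 u v HD) as [h1 h2].
    repeat split; intros E; rewrite E in *; lra. }
  assert (Hquot : forall a b, 0 < a * b -> 0 < b / a).
  { intros a b H. assert (a <> 0) by (intros E; rewrite E in H; lra).
    assert (0 < a * a) by nra.
    replace (b / a) with (a * b / (a * a)) by (field; assumption).
    apply Rdiv_lt_0_compat; assumption. }
  assert (Sh : smooth_on D (fun u v => nu1 u v - nu2 u v))
    by (apply smooth_minus; assumption).
  assert (Sf : smooth_on D (fun u v => du nu2 u v / gam2 u v)).
  { apply smooth_div; auto using smooth_du. intros; apply Hnz; assumption. }
  assert (Sg : smooth_on D (fun u v => dv nu1 u v / gam1 u v)).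
  { apply smooth_div; auto using smooth_dv. intros; apply Hnz; assumption. }
  assert (Hh : forall u v, D (u, v) -> nu1 u v - nu2 u v <> 0).
  { intros u v HD; specialize (nu_pos u v HD); lra. }
  split; [apply smooth_div; assumption|]. split; [apply smooth_div; assumption|].
  intros u v HD.
  destruct (Hnz u v HD) as (g1 & g2 & n1 & n2).
  destruct (cond1 u v HD) as [c1 c2]. apply Hquot in c1, c2.
  pose proof (nu_pos u v HD) as Hp. pose proof (Hh u v HD) as Hp0.
  destruct (cond21 u v HD) as [e1 e2]. specialize (cond22 u v HD).
  set (f := fun u v => du nu2 u v / gam2 u v) in *.
  set (g := fun u v => dv nu1 u v / gam1 u v) in *.
  pose proof (smooth_is_dv D f u v Sf HD) as Df.
  pose proof (smooth_is_du D g u v Sg HD) as Dg.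
  assert (E1 : du g u v / g u v = du nu1 u v / (nu1 u v - nu2 u v)).
  { rewrite <- e1. symmetry. apply is_derive_unique.
    eapply is_derive_val; [apply (is_derive_comp ln (fun x => g x v));
      [apply is_derive_ln; exact c1|exact Dg]|].
    unfold scal; simpl; unfold mult; simpl. reflexivity. }
  assert (E2 : dv f u v / f u v = - (dv nu2 u v / (nu1 u v - nu2 u v))).
  { rewrite <- e2. symmetry. apply is_derive_unique.
    eapply is_derive_val; [apply (is_derive_comp ln (fun y => f u y));
      [apply is_derive_ln; exact c2|exact Df]|].
    unfold scal; simpl; unfold mult; simpl. reflexivity. }
  change (0 < f u v) in c2. change (0 < g u v) in c1.
  assert (Hpv : dv (fun u v => f u v / (nu1 u v - nu2 u v)) u v =
    - (gam1 u v * (f u v / (nu1 u v - nu2 u v)) * (g u v / (nu1 u v - nu2 u v)))).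
  { apply is_derive_unique.
    assert (Dh : is_derive (fun y => nu1 u y - nu2 u y) v (dv nu1 u v - dv nu2 u v)).
    { eapply is_derive_sub; [apply (smooth_is_dv D nu1)|apply (smooth_is_dv D nu2)|];
        auto. }
    eapply is_derive_val; [apply is_derive_div; [exact Df|exact Dh|exact Hp0]|].
    assert (E3 : dv f u v = - (dv nu2 u v / (nu1 u v - nu2 u v)) * f u v)
      by (rewrite <- E2; field; lra).
    rewrite E3. replace (gam1 u v) with (dv nu1 u v / g u v)
      by (unfold g; field; auto). field; split; [exact Hp0|lra]. }
  assert (Hqu : du (fun u v => g u v / (nu1 u v - nu2 u v)) u v =
    gam2 u v * (f u v / (nu1 u v - nu2 u v)) * (g u v / (nu1 u v - nu2 u v))).
  { apply is_derive_unique.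
    assert (Dh : is_derive (fun x => nu1 x v - nu2 x v) u (du nu1 u v - du nu2 u v)).
    { eapply is_derive_sub; [apply (smooth_is_du D nu1)|apply (smooth_is_du D nu2)|];
        auto. }
    eapply is_derive_val; [apply is_derive_div; [exact Dg|exact Dh|exact Hp0]|].
    assert (E3 : du g u v = du nu1 u v / (nu1 u v - nu2 u v) * g u v)
      by (rewrite <- E1; field; lra).
    rewrite E3. replace (gam2 u v) with (du nu2 u v / f u v)
      by (unfold f; field; auto). field; split; [exact Hp0|lra]. }
  change (du nu2 u v / gam2 u v) with (f u v).
  change (dv nu1 u v / gam1 u v) with (g u v).
  split; [apply Rdiv_lt_0_compat; assumption|].
  split; [apply Rdiv_lt_0_compat; assumption|].
  split; [unfold g; field; auto|].
  split; [unfold f; field; auto|].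
  split; [exact Hpv|]. split; [exact Hqu|].
  change (dv (fun x y => du nu2 x y / gam2 x y / (nu1 x y - nu2 x y)) u v)
    with (dv (fun x y => f x y / (nu1 x y - nu2 x y)) u v).
  change (du (fun x y => dv nu1 x y / gam1 x y / (nu1 x y - nu2 x y)) u v)
    with (du (fun x y => g x y / (nu1 x y - nu2 x y)) u v).
  rewrite Hpv, Hqu.
  assert (D2 : du (fun s t => gam2 s t ^ 2) u v = 2 * gam2 u v * du gam2 u v).
  { apply is_derive_unique. pose proof (smooth_is_du D gam2 u v gam2_smooth HD) as d.
    apply (is_derive_ext (fun x => gam2 x v * gam2 x v)); [intros; simpl; ring|].
    eapply is_derive_mul; [exact d|exact d|ring]. }
  assert (D1 : dv (fun s t => gam1 s t ^ 2) u v = 2 * gam1 u v * dv gam1 u v).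
  { apply is_derive_unique. pose proof (smooth_is_dv D gam1 u v gam1_smooth HD) as d.
    apply (is_derive_ext (fun y => gam1 u y * gam1 u y)); [intros; simpl; ring|].
    eapply is_derive_mul; [exact d|exact d|ring]. }
  rewrite D1, D2 in cond22.
  replace (nu1 u v * (f u v / (nu1 u v - nu2 u v)) *
            (nu2 u v * (g u v / (nu1 u v - nu2 u v))))
    with (nu1 u v * nu2 u v * (f u v / (nu1 u v - nu2 u v)) *
            (g u v / (nu1 u v - nu2 u v))) by ring.
  rewrite <- cond22. unfold f, g. field. repeat split; auto.
Qed.

(** * Existence of a framed surface *)

(** Index of the unknowns of the linear system: one coordinate of each of z, X, Y, l. *)
Inductive unknown : Set := Uz | Ux | Uy | Ul.

Definition unknowns : list unknown := Uz :: Ux :: Uy :: Ul :: nil.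

Lemma in_unknowns (i : unknown) : In i unknowns.
Proof. destruct i; simpl; tauto. Qed.

(** The matrices of the system formed by [z_u = p X], [z_v = q Y] and the frame
    equations. *)
Definition coef_u (p a b : R -> R -> R) (i j : unknown) : R -> R -> R :=
  match i, j with
  | Uz, Ux => p
  | Ux, Uy => a
  | Ux, Ul => fun u v => - b u v
  | Uy, Ux => fun u v => - a u v
  | Ul, Ux => fun u v => - b u v
  | _, _ => fun _ _ => 0
  end.

Definition coef_v (q c d : R -> R -> R) (i j : unknown) : R -> R -> R :=
  match i, j with
  | Uz, Uy => q
  | Ux, Uy => c
  | Uy, Ux => fun u v => - c u v
  | Uy, Ul => fun u v => - d u v
  | Ul, Uy => fun u v => - d u v
  | _, _ => fun _ _ => 0
  end.

(** The fields [X], [Y], [l] satisfy the frame equations, and [z] has its parameter lines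
    along [X] and [Y], with speeds [p] and [q]. *)
Definition framed_surface (D : R * R -> Prop) (p q a b c d : R -> R -> R)
  (z X Y l : R -> R -> vec) : Prop :=
  frame_eqs D a b c d X Y l /\
  forall u v, D (u, v) ->
    vderiv (fun x => z x v) u (scal (p u v) (X u v)) /\
    vderiv (fun y => z u y) v (scal (q u v) (Y u v)).

(** The radius [r] does not depend on the initial values, which need not be orthonormal. *)
Lemma framed_surface_exists (D : R * R -> Prop) (u0 v0 : R)
  (p q a b c d : R -> R -> R) :
  open D -> D (u0, v0) ->
  smooth_on D p -> smooth_on D q -> smooth_on D a -> smooth_on D b ->
  smooth_on D c -> smooth_on D d ->
  (forall u v, D (u, v) ->
     dv p u v = - (q u v * a u v) /\ du q u v = p u v * c u v /\
     dv a u v + b u v * d u v = du c u v /\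
     dv b u v = - (a u v * d u v) /\ du d u v = b u v * c u v) ->
  exists r, 0 < r /\ (forall w, square u0 v0 r w -> D w) /\
    forall z0 X0 Y0 l0, exists z X Y l,
      z u0 v0 = z0 /\ X u0 v0 = X0 /\ Y u0 v0 = Y0 /\ l u0 v0 = l0 /\
      vsmooth_on (square u0 v0 r) z /\ vsmooth_on (square u0 v0 r) X /\
      vsmooth_on (square u0 v0 r) Y /\ vsmooth_on (square u0 v0 r) l /\
      framed_surface (square u0 v0 r) p q a b c d z X Y l.
Proof.
  intros HO H0 Sp Sq Sa Sb Sc Sd Hint.
  assert (SP : forall i j, smooth_on D (coef_u p a b i j)).
  { intros i j; destruct i, j; simpl; auto using smooth_const, smooth_opp. }
  assert (SQ : forall i j, smooth_on D (coef_v q c d i j)).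
  { intros i j; destruct i, j; simpl; auto using smooth_const, smooth_opp. }
  assert (Dc : forall u v k, du (fun _ _ => k) u v = 0 /\ dv (fun _ _ => k) u v = 0)
    by (intros u v k; split; [apply (Derive_const k u)|apply (Derive_const k v)]).
  assert (Do : forall f u v, du (fun s t => - f s t) u v = - du f u v /\
                dv (fun s t => - f s t) u v = - dv f u v).
  { intros f u v; split; [apply (Derive_opp (fun x => f x v))
                         |apply (Derive_opp (fun y => f u y))]. }
  destruct (pfaffian_exists unknowns in_unknowns (coef_u p a b) (coef_v q c d)
              D u0 v0 HO H0) as (r & Hr & HrD & Hsol).
  - intros i j; apply smooth_class, SP.
  - intros i j; apply smooth_class, SQ.
  - intros i j u v HD. destruct (Hint u v HD) as (h1 & h2 & h3 & h4 & h5).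
    destruct (Do a u v) as [_ oa]. destruct (Do b u v) as [_ ob].
    destruct (Do c u v) as [oc _]. destruct (Do d u v) as [od _].
    destruct (Dc u v 0) as [z1 z2].
    destruct i, j; unfold coef_u, coef_v; cbn [lsum fold_right unknowns];
      rewrite ?oa, ?ob, ?oc, ?od, ?z1, ?z2, ?h1, ?h2, ?h4, ?h5; try ring;
      rewrite <- ?h3; ring.
  - exists r. split; [exact Hr|].
    assert (HsD : forall w, square u0 v0 r w -> D w).
    { intros [u v] [Hu Hv]. apply HrD; assumption. }
    split; [exact HsD|].
    intros z0 X0 Y0 l0.
    pose (ini := fun (cr : vec -> R) (i : unknown) => cr
            match i with Uz => z0 | Ux => X0 | Uy => Y0 | Ul => l0 end).
    destruct (Hsol (ini crd1)) as (A1 & I1 & C1 & E1).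
    destruct (Hsol (ini crd2)) as (A2 & I2 & C2 & E2).
    destruct (Hsol (ini crd3)) as (A3 & I3 & C3 & E3).
    assert (HA : forall A : unknown -> R -> R -> R, (forall i, cont2 (A i)) ->
      (forall i u v, Rabs (u - u0) < r -> Rabs (v - v0) < r ->
        is_derive (fun x => A i x v) u
          (lsum unknowns (fun j => coef_u p a b i j u v * A j u v)) /\
        is_derive (fun y => A i u y) v
          (lsum unknowns (fun j => coef_v q c d i j u v * A j u v))) ->
      (forall i, smooth_on (square u0 v0 r) (A i)) /\
      frame_eqs1 (square u0 v0 r) a b c d (A Ux) (A Uy) (A Ul) /\
      forall u v, square u0 v0 r (u, v) ->
        is_derive (fun x => A Uz x v) u (p u v * A Ux u v) /\
        is_derive (fun y => A Uz u y) v (q u v * A Uy u v)).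
    { intros A CA EA. split; [|split].
      - apply (pfaffian_smooth unknowns (coef_u p a b) (coef_v q c d)).
        + apply square_open.
        + intros i j. apply (smooth_sub D); [exact HsD|apply SP].
        + intros i j. apply (smooth_sub D); [exact HsD|apply SQ].
        + exact CA.
        + intros i u v [Hu Hv]; apply EA; assumption.
      - intros u v [Hu Hv]; simpl in Hu, Hv.
        destruct (EA Ux u v Hu Hv) as [x1 x2]. destruct (EA Uy u v Hu Hv) as [y1 y2].
        destruct (EA Ul u v Hu Hv) as [l1 l2].
        split_ands; (eapply is_derive_val; [eassumption|]); simpl; ring.
      - intros u v [Hu Hv]; simpl in Hu, Hv. destruct (EA Uz u v Hu Hv) as [x1 x2].
        split; (eapply is_derive_val; [eassumption|]); simpl; ring. }
    destruct (HA A1 C1 E1) as (S1 & F1 & G1). destruct (HA A2 C2 E2) as (S2 & F2 & G2).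
    destruct (HA A3 C3 E3) as (S3 & F3 & G3).
    pose (V := fun i u v => (A1 i u v, A2 i u v, A3 i u v) : vec).
    assert (SV : forall i, vsmooth_on (square u0 v0 r) (V i)).
    { intros i; split_ands; [apply S1|apply S2|apply S3]. }
    assert (IV : forall i, V i u0 v0 =
              match i with Uz => z0 | Ux => X0 | Uy => Y0 | Ul => l0 end).
    { intros i. unfold V. rewrite I1, I2, I3. unfold ini.
      destruct i; apply vec_eq; reflexivity. }
    exists (V Uz), (V Ux), (V Uy), (V Ul).
    split; [apply IV|]. split; [apply IV|]. split; [apply IV|]. split; [apply IV|].
    split; [apply SV|]. split; [apply SV|]. split; [apply SV|]. split; [apply SV|].
    split.
    + apply frame_eqs_coord. split; [exact F1|]. split; [exact F2|exact F3].
    + intros u v Huv. destruct (G1 u v Huv), (G2 u v Huv), (G3 u v Huv).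
      split; split_ands; assumption.
Qed.

(** * From the frame equations to the surface *)

Lemma mink_plus_scal_l (f g : R) (a b w : vec) :
  mink (plus (scal f a) (scal g b)) w = f * mink a w + g * mink b w.
Proof.
  unfold mink, crd1, crd2, crd3; simpl. unfold plus, scal; simpl.
  unfold plus, scal; simpl. unfold mult; simpl. ring.
Qed.

Lemma mink_plus_scal_r (f g : R) (a b w : vec) :
  mink w (plus (scal f a) (scal g b)) = f * mink w a + g * mink w b.
Proof. rewrite mink_sym, mink_plus_scal_l, !(mink_sym _ w); reflexivity. Qed.

Lemma det3_scal2 (a b : R) (X Y l : vec) :
  det3 (scal a X) (scal b Y) l = a * b * det3 X Y l.
Proof.
  unfold det3. destruct (crd_scal a X) as (-> & -> & ->).
  destruct (crd_scal b Y) as (-> & -> & ->). ring.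
Qed.

Lemma sqrt_mul_self (p : R) : 0 < p -> sqrt (p * p) = p.
Proof. intros Hp. apply sqrt_square; lra. Qed.

Lemma scal_inv_scal (p : R) (X : vec) : p <> 0 -> scal (/ p) (scal p X) = X.
Proof.
  intros Hp.
  assert (E : forall x, / p * (p * x) = x) by (intros; field; exact Hp).
  apply vec_eq; [destruct (crd_scal (/ p) (scal p X)) as (-> & _ & _);
                 destruct (crd_scal p X) as (-> & _ & _)
                |destruct (crd_scal (/ p) (scal p X)) as (_ & -> & _);
                 destruct (crd_scal p X) as (_ & -> & _)
                |destruct (crd_scal (/ p) (scal p X)) as (_ & _ & ->);
                 destruct (crd_scal p X) as (_ & _ & ->)]; apply E.
Qed.

Lemma scal_scal_inv (p : R) (X : vec) : p <> 0 -> scal p (scal (/ p) X) = X.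
Proof.
  intros Hp. pose proof (scal_inv_scal (/ p) X (Rinv_neq_0_compat p Hp)) as H.
  rewrite Rinv_inv in H. exact H.
Qed.

(** A framed surface whose frame is orthonormal and positively oriented has the
    prescribed invariants. *)
Lemma framed_surface_geometry (D : R * R -> Prop)
  (p q nu1 nu2 gam1 gam2 : R -> R -> R) (z X Y l : R -> R -> vec) :
  open D -> integrable_invariants D p q nu1 nu2 gam1 gam2 ->
  (forall u v, D (u, v) ->
     0 < nu1 u v - nu2 u v /\ gam1 u v <> 0 /\ gam2 u v <> 0) ->
  vsmooth_on D z -> vsmooth_on D l ->
  framed_surface D p q (fun u v => gam1 u v * p u v) (fun u v => nu1 u v * p u v)
    (fun u v => gam2 u v * q u v) (fun u v => nu2 u v * q u v) z X Y l ->
  (forall u v, D (u, v) -> orthonormal (X u v) (Y u v) (l u v) /\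
     0 < det3 (X u v) (Y u v) (l u v)) ->
  (space_like_surface D z l /\ strongly_regular D z l /\
   has_invariants D z l nu1 nu2 gam1 gam2 /\ principal_parameters D z l) /\
  forall u v, D (u, v) -> frameX z u v = X u v /\ frameY z u v = Y u v.
Proof.
  intros HO (Sp & Sq & Hint) Hreg Sz Sl [HF Hz] Hon.
  assert (Zu : forall u v, D (u, v) -> vdu z u v = scal (p u v) (X u v))
    by (intros u v HD; destruct (Hz u v HD) as [h _]; apply vderiv_vdu; exact h).
  assert (Zv : forall u v, D (u, v) -> vdv z u v = scal (q u v) (Y u v))
    by (intros u v HD; destruct (Hz u v HD) as [_ h]; apply vderiv_vdv; exact h).
  assert (HE : forall u v, D (u, v) -> coefE z u v = p u v * p u v).
  { intros u v HD. unfold coefE. rewrite Zu, mink_scal_l, mink_scal_r by exact HD.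
    destruct (Hon u v HD) as [(h1 & _) _]. rewrite h1; ring. }
  assert (HG : forall u v, D (u, v) -> coefG z u v = q u v * q u v).
  { intros u v HD. unfold coefG. rewrite Zv, mink_scal_l, mink_scal_r by exact HD.
    destruct (Hon u v HD) as [(_ & h1 & _) _]. rewrite h1; ring. }
  assert (HFc : forall u v, D (u, v) -> coefF z u v = 0).
  { intros u v HD. unfold coefF. rewrite Zu, Zv, mink_scal_l, mink_scal_r by exact HD.
    destruct (Hon u v HD) as [(_ & _ & _ & h1 & _) _]. rewrite h1; ring. }
  assert (HX : forall u v, D (u, v) -> frameX z u v = X u v).
  { intros u v HD. destruct (Hint u v HD) as (hp & _). unfold frameX.
    rewrite HE, Zu, sqrt_mul_self by assumption. apply scal_inv_scal; lra. }
  assert (HY : forall u v, D (u, v) -> frameY z u v = Y u v).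
  { intros u v HD. destruct (Hint u v HD) as (_ & hq & _). unfold frameY.
    rewrite HG, Zv, sqrt_mul_self by assumption. apply scal_inv_scal; lra. }
  assert (HL : forall u v, D (u, v) -> coefL z l u v = nu1 u v * (p u v * p u v)).
  { intros u v HD. unfold coefL.
    destruct (HF u v HD) as (hx & _). destruct (Hon u v HD) as [(_ & _ & h3 & _ & h5 & h6) _].
    rewrite (vderiv_vdu (vdu z) u v (plus (scal (du p u v) (X u v)) (scal (p u v)
       (comb 0 (X u v) (gam1 u v * p u v) (Y u v) (- (nu1 u v * p u v)) (l u v))))).
    - rewrite mink_plus_scal_r, mink_comb_r, (mink_sym _ (X u v)), (mink_sym _ (Y u v)),
        h3, h5, h6. ring.
    - apply (vderiv_ext_loc (fun x => scal (p x v) (X x v))).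
      + eapply filter_imp; [|apply (locally_open1 D u v HO HD)].
        intros x Hx; symmetry; apply Zu, Hx.
      + apply (vderiv_scal (fun x => p x v) (fun x => X x v)); [|exact hx].
        apply (smooth_is_du D p); assumption. }
  assert (HM : forall u v, D (u, v) -> coefM z l u v = 0).
  { intros u v HD. unfold coefM.
    destruct (HF u v HD) as (_ & _ & _ & hx & _).
    destruct (Hon u v HD) as [(_ & _ & h3 & _ & h5 & h6) _].
    rewrite (vderiv_vdv (vdu z) u v (plus (scal (dv p u v) (X u v)) (scal (p u v)
       (comb 0 (X u v) (gam2 u v * q u v) (Y u v) 0 (l u v))))).
    - rewrite mink_plus_scal_r, mink_comb_r, (mink_sym _ (X u v)), (mink_sym _ (Y u v)),
        h3, h5, h6. ring.
    - apply (vderiv_ext_loc (fun y => scal (p u y) (X u y))).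
      + eapply filter_imp; [|apply (locally_open2 D u v HO HD)].
        intros x Hx; symmetry; apply Zu, Hx.
      + apply (vderiv_scal (fun y => p u y) (fun y => X u y)); [|exact hx].
        apply (smooth_is_dv D p); assumption. }
  assert (HN : forall u v, D (u, v) -> coefN z l u v = nu2 u v * (q u v * q u v)).
  { intros u v HD. unfold coefN.
    destruct (HF u v HD) as (_ & _ & _ & _ & hy & _).
    destruct (Hon u v HD) as [(_ & _ & h3 & _ & h5 & h6) _].
    rewrite (vderiv_vdv (vdv z) u v (plus (scal (dv q u v) (Y u v)) (scal (q u v)
       (comb (- (gam2 u v * q u v)) (X u v) 0 (Y u v) (- (nu2 u v * q u v)) (l u v))))).
    - rewrite mink_plus_scal_r, mink_comb_r, (mink_sym _ (X u v)), (mink_sym _ (Y u v)),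
        h3, h5, h6. ring.
    - apply (vderiv_ext_loc (fun y => scal (q u y) (Y u y))).
      + eapply filter_imp; [|apply (locally_open2 D u v HO HD)].
        intros x Hx; symmetry; apply Zv, Hx.
      + apply (vderiv_scal (fun y => q u y) (fun y => Y u y)); [|exact hy].
        apply (smooth_is_dv D q); assumption. }
  assert (HEv : forall u v, D (u, v) -> dv (coefE z) u v = 2 * p u v * dv p u v).
  { intros u v HD. rewrite (dv_ext_on D _ (fun s t => p s t * p s t) u v HO HD HE).
    apply is_derive_unique. pose proof (smooth_is_dv D p u v Sp HD).
    eapply is_derive_mul; [eassumption|eassumption|ring]. }
  assert (HGu : forall u v, D (u, v) -> du (coefG z) u v = 2 * q u v * du q u v).
  { intros u v HD. rewrite (du_ext_on D _ (fun s t => q s t * q s t) u v HO HD HG).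
    apply is_derive_unique. pose proof (smooth_is_du D q u v Sq HD).
    eapply is_derive_mul; [eassumption|eassumption|ring]. }
  assert (Hinv : has_invariants D z l nu1 nu2 gam1 gam2).
  { intros u v HD. destruct (Hint u v HD) as (hp & hq & _ & _ & hpv & hqu & _).
    unfold inv_nu1, inv_nu2, inv_gamma1, inv_gamma2.
    rewrite HL, HN, HEv, HGu, HE, HG, !sqrt_mul_self, hpv, hqu by assumption.
    repeat split; field; split_ands; lra. }
  split; [|auto]. split; [split; [exact Sz|split; [|split]]|split; [|split]].
  - intros u v HD s t Hst. destruct (Hint u v HD) as (hp & hq & _).
    rewrite HE, HG, HFc by exact HD.
    replace (p u v * p u v * s ^ 2 + 2 * 0 * (s * t) + q u v * q u v * t ^ 2)
      with ((p u v * s) ^ 2 + (q u v * t) ^ 2) by ring.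
    assert (h : p u v * s <> 0 \/ q u v * t <> 0).
    { destruct Hst; [left|right]; apply Rmult_integral_contrapositive; split; lra. }
    pose proof (pow2_ge_0 (p u v * s)). pose proof (pow2_ge_0 (q u v * t)).
    destruct h as [h|h]; apply pow2_gt_0 in h; lra.
  - split; [exact Sl|]. intros u v HD.
    destruct (Hon u v HD) as [(_ & _ & h3 & _ & h5 & h6) hd].
    rewrite HX, HY, Zu, Zv, !mink_scal_r, (mink_sym _ (X u v)), (mink_sym _ (Y u v)), h5, h6
      by exact HD.
    repeat split; try ring; assumption.
  - intros u v HD (k & k1 & _ & k2). destruct (Hint u v HD) as (hp & hq & _).
    rewrite HL, HE in k1 by exact HD. rewrite HN, HG in k2 by exact HD.
    apply Rmult_eq_reg_r in k1; [|apply Rgt_not_eq, Rmult_lt_0_compat; assumption].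
    apply Rmult_eq_reg_r in k2; [|apply Rgt_not_eq, Rmult_lt_0_compat; assumption].
    destruct (Hreg u v HD); lra.
  - intros u v HD. destruct (Hinv u v HD) as (-> & -> & -> & ->).
    destruct (Hreg u v HD) as (h1 & h2 & h3).
    repeat apply Rmult_integral_contrapositive_currified; try assumption. lra.
  - exact Hinv.
  - intros u v HD; split; [apply HFc|apply HM]; exact HD.
Qed.

(** * Uniqueness *)

Lemma mink_du_eq (D : R * R -> Prop) (s t : R -> R -> vec) (k : R -> R -> R)
  (u v k' : R) :
  open D -> vsmooth_on D s -> vsmooth_on D t -> D (u, v) ->
  (forall x y, D (x, y) -> mink (s x y) (t x y) = k x y) ->
  is_derive (fun x => k x v) u k' ->
  mink (vdu s u v) (t u v) + mink (s u v) (vdu t u v) = k'.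
Proof.
  intros HO Ss St HD H Hk.
  pose proof (vderiv_mink _ _ u _ _ _ (vsmooth_is_vdu D s u v Ss HD)
                (vsmooth_is_vdu D t u v St HD) eq_refl) as h.
  apply is_derive_unique in h. rewrite <- h. apply is_derive_unique.
  apply (is_derive_ext_loc (fun x => k x v)); [|exact Hk].
  eapply filter_imp; [|apply (locally_open1 D u v HO HD)].
  intros x Hx; symmetry; apply H, Hx.
Qed.

Lemma mink_dv_eq (D : R * R -> Prop) (s t : R -> R -> vec) (k : R -> R -> R)
  (u v k' : R) :
  open D -> vsmooth_on D s -> vsmooth_on D t -> D (u, v) ->
  (forall x y, D (x, y) -> mink (s x y) (t x y) = k x y) ->
  is_derive (fun y => k u y) v k' ->
  mink (vdv s u v) (t u v) + mink (s u v) (vdv t u v) = k'.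
Proof.
  intros HO Ss St HD H Hk.
  pose proof (vderiv_mink _ _ v _ _ _ (vsmooth_is_vdv D s u v Ss HD)
                (vsmooth_is_vdv D t u v St HD) eq_refl) as h.
  apply is_derive_unique in h. rewrite <- h. apply is_derive_unique.
  apply (is_derive_ext_loc (fun y => k u y)); [|exact Hk].
  eapply filter_imp; [|apply (locally_open2 D u v HO HD)].
  intros x Hx; symmetry; apply H, Hx.
Qed.

(** Rodrigues' formulas, and the Codazzi equations obtained from them by
    cross-differentiation, give the speeds of the parameter lines. *)
Lemma surface_speeds (D : R * R -> Prop) (nu1 nu2 gam1 gam2 p q : R -> R -> R)
  (z l : R -> R -> vec) :
  open D -> integrable_invariants D p q nu1 nu2 gam1 gam2 ->
  smooth_on D nu1 -> smooth_on D nu2 ->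
  (forall u v, D (u, v) ->
     0 < nu1 u v - nu2 u v /\ gam1 u v <> 0 /\ gam2 u v <> 0) ->
  space_like_surface D z l -> principal_parameters D z l ->
  has_invariants D z l nu1 nu2 gam1 gam2 ->
  forall u v, D (u, v) ->
    coefE z u v = p u v * p u v /\ coefG z u v = q u v * q u v /\
    vdu l u v = scal (- nu1 u v) (vdu z u v) /\
    vdv l u v = scal (- nu2 u v) (vdv z u v) /\
    0 < det3 (vdu z u v) (vdv z u v) (l u v).
Proof.
  intros HO (Sp & Sq & Hint) Sn1 Sn2 Hreg (Sz & Hsp & (Sl & Hl) & _) Hpr Hinv.
  pose proof (vsmooth_vdu D z Sz) as Sa. pose proof (vsmooth_vdv D z Sz) as Sb.
  assert (HE : forall u v, D (u, v) -> 0 < coefE z u v).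
  { intros u v HD. pose proof (Hsp u v HD 1 0 (or_introl R1_neq_R0)). lra. }
  assert (HG : forall u v, D (u, v) -> 0 < coefG z u v).
  { intros u v HD. pose proof (Hsp u v HD 0 1 (or_intror R1_neq_R0)). lra. }
  assert (Hdet : forall u v, D (u, v) -> 0 < det3 (vdu z u v) (vdv z u v) (l u v)).
  { intros u v HD. destruct (Hl u v HD) as (_ & _ & _ & h).
    unfold frameX, frameY in h. rewrite det3_scal2 in h.
    assert (h1 : 0 < / sqrt (coefE z u v) * / sqrt (coefG z u v)).
    { apply Rmult_lt_0_compat; apply Rinv_0_lt_compat, sqrt_lt_R0; auto. }
    apply (Rmult_lt_reg_l _ _ _ h1). lra. }
  assert (Hrod : forall u v, D (u, v) ->
    vdu l u v = scal (- nu1 u v) (vdu z u v) /\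
    vdv l u v = scal (- nu2 u v) (vdv z u v)).
  { intros u v HD.
    destruct (Hl u v HD) as (ll & la & lb & _).
    destruct (Hpr u v HD) as [hF hM]. destruct (Hinv u v HD) as (i1 & i2 & _ & _).
    pose proof (HE u v HD) as E0. pose proof (HG u v HD) as G0.
    assert (hL : coefL z l u v = nu1 u v * coefE z u v)
      by (rewrite <- i1; unfold inv_nu1; field; lra).
    assert (hN : coefN z l u v = nu2 u v * coefG z u v)
      by (rewrite <- i2; unfold inv_nu2; field; lra).
    unfold coefL, coefN, coefM, coefE, coefF, coefG in *.
    pose proof (vsmooth_mixed D z u v HO Sz HD) as Hmix.
    pose proof (mink_du_eq D l (vdu z) (fun _ _ => 0) u v 0 HO Sl Sa HD
      (fun x y h => proj1 (proj2 (Hl x y h))) (is_derive_cst 0 u)) as d1.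
    pose proof (mink_dv_eq D l (vdu z) (fun _ _ => 0) u v 0 HO Sl Sa HD
      (fun x y h => proj1 (proj2 (Hl x y h))) (is_derive_cst 0 v)) as d2.
    pose proof (mink_du_eq D l (vdv z) (fun _ _ => 0) u v 0 HO Sl Sb HD
      (fun x y h => proj1 (proj2 (proj2 (Hl x y h)))) (is_derive_cst 0 u)) as d3.
    pose proof (mink_dv_eq D l (vdv z) (fun _ _ => 0) u v 0 HO Sl Sb HD
      (fun x y h => proj1 (proj2 (proj2 (Hl x y h)))) (is_derive_cst 0 v)) as d4.
    pose proof (mink_du_eq D l l (fun _ _ => -1) u v 0 HO Sl Sl HD
      (fun x y h => proj1 (Hl x y h)) (is_derive_cst (-1) u)) as d5.
    pose proof (mink_dv_eq D l l (fun _ _ => -1) u v 0 HO Sl Sl HD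
      (fun x y h => proj1 (Hl x y h)) (is_derive_cst (-1) v)) as d6.
    rewrite (mink_sym (l u v) (vdu l u v)) in d5.
    rewrite (mink_sym (l u v) (vdv l u v)) in d6.
    rewrite Hmix in d3.
    rewrite (mink_sym (l u v) (vdu z u v)) in la.
    rewrite (mink_sym (l u v) (vdv z u v)) in lb.
    assert (Hd0 : det3 (vdu z u v) (vdv z u v) (l u v) <> 0)
      by (apply Rgt_not_eq, Hdet, HD).
    split; apply (mink_nondegenerate _ _ _ _ _ Hd0); rewrite mink_scal_l;
      rewrite ?(mink_sym (vdv z u v) (vdu z u v)), ?hF, ?la, ?lb; lra. }
  intros u v HD.
  destruct (Hpr u v HD) as [hF hM]. destruct (Hinv u v HD) as (_ & _ & i3 & i4).
  destruct (Hint u v HD) as (hp & hq & c1 & c2 & _).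
  destruct (Hreg u v HD) as (hn & hg1 & hg2).
  pose proof (HE u v HD) as E0. pose proof (HG u v HD) as G0.
  assert (hEv : dv (coefE z) u v = 2 * mink (vdu z u v) (vdv (vdu z) u v)).
  { apply is_derive_unique. pose proof (vsmooth_is_vdv D (vdu z) u v Sa HD) as h.
    apply (vderiv_mink _ _ _ _ _ _ h h).
    rewrite (mink_sym (vdv (vdu z) u v)); ring. }
  assert (hGu : du (coefG z) u v = 2 * mink (vdv z u v) (vdu (vdv z) u v)).
  { apply is_derive_unique. pose proof (vsmooth_is_vdu D (vdv z) u v Sb HD) as h.
    apply (vderiv_mink _ _ _ _ _ _ h h).
    rewrite (mink_sym (vdu (vdv z) u v)); ring. }
  (* Cross-differentiation of Rodrigues' formulas; the mixed derivatives of l are then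
     compared through their products with z_u and z_v. *)
  assert (e1 : vdv (vdu l) u v = plus (scal (- dv nu1 u v) (vdu z u v))
                 (scal (- nu1 u v) (vdv (vdu z) u v))).
  { apply vderiv_vdv.
    apply (vderiv_ext_loc (fun y => scal (- nu1 u y) (vdu z u y))).
    - eapply filter_imp; [|apply (locally_open2 D u v HO HD)].
      intros y Hy; symmetry; apply Hrod, Hy.
    - apply (vderiv_scal (fun y => - nu1 u y) (fun y => vdu z u y)).
      + apply (is_derive_opp (fun y => nu1 u y)), (smooth_is_dv D nu1); assumption.
      + apply (vsmooth_is_vdv D (vdu z)); assumption. }
  assert (e2 : vdu (vdv l) u v = plus (scal (- du nu2 u v) (vdv z u v))
                 (scal (- nu2 u v) (vdu (vdv z) u v))).
  { apply vderiv_vdu.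
    apply (vderiv_ext_loc (fun x => scal (- nu2 x v) (vdv z x v))).
    - eapply filter_imp; [|apply (locally_open1 D u v HO HD)].
      intros x Hx; symmetry; apply Hrod, Hx.
    - apply (vderiv_scal (fun x => - nu2 x v) (fun x => vdv z x v)).
      + apply (is_derive_opp (fun x => nu2 x v)), (smooth_is_du D nu2); assumption.
      + apply (vsmooth_is_vdu D (vdv z)); assumption. }
  pose proof (vsmooth_mixed D l u v HO Sl HD) as Hmix.
  rewrite e1, e2, (vsmooth_mixed D z u v HO Sz HD) in Hmix.
  rewrite (vsmooth_mixed D z u v HO Sz HD) in hGu.
  pose proof (f_equal (fun w => mink (vdu z u v) w) Hmix) as m1.
  pose proof (f_equal (fun w => mink (vdv z u v) w) Hmix) as m2.
  cbv beta in m1, m2. rewrite !mink_plus_scal_r in m1, m2.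
  rewrite (mink_sym (vdv z u v) (vdu z u v)) in m2.
  unfold coefF in hF. rewrite hF in m1, m2.
  fold (coefE z u v) in m1. fold (coefG z u v) in m2.
  unfold inv_gamma1 in i3. unfold inv_gamma2 in i4.
  rewrite hEv in i3. rewrite hGu in i4.
  set (sE := sqrt (coefE z u v)) in *. set (sG := sqrt (coefG z u v)) in *.
  assert (pE : 0 < sE) by (apply sqrt_lt_R0, E0).
  assert (pG : 0 < sG) by (apply sqrt_lt_R0, G0).
  assert (qE : coefE z u v = sE * sE) by (symmetry; apply sqrt_sqrt; lra).
  assert (qG : coefG z u v = sG * sG) by (symmetry; apply sqrt_sqrt; lra).
  rewrite qE in m1, i3. rewrite qG in m2, i4.
  assert (tE : mink (vdu z u v) (vdv (vdu z) u v) = - (gam1 u v * (sE * sE) * sG))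
    by (rewrite <- i3; field; lra).
  assert (tG : mink (vdv z u v) (vdv (vdu z) u v) = gam2 u v * (sG * sG) * sE)
    by (rewrite <- i4; field; lra).
  rewrite tE in m1. rewrite tG in m2. rewrite c1 in m1. rewrite c2 in m2.
  assert (rG : sG = q u v).
  { apply (Rmult_eq_reg_l (gam1 u v * (nu1 u v - nu2 u v) * (sE * sE))).
    - lra.
    - repeat apply Rmult_integral_contrapositive_currified; lra. }
  assert (rE : sE = p u v).
  { apply (Rmult_eq_reg_l (gam2 u v * (nu1 u v - nu2 u v) * (sG * sG))).
    - lra.
    - repeat apply Rmult_integral_contrapositive_currified; lra. }
  rewrite qE, qG, rE, rG. destruct (Hrod u v HD) as [r1 r2].
  split; [reflexivity|]. split; [reflexivity|]. split; [exact r1|].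
  split; [exact r2|apply Hdet, HD].
Qed.

(** The moving frame of a surface with the prescribed invariants satisfies the frame
    equations. *)
Lemma surface_framed (D : R * R -> Prop) (nu1 nu2 gam1 gam2 p q : R -> R -> R)
  (z l : R -> R -> vec) :
  open D -> integrable_invariants D p q nu1 nu2 gam1 gam2 ->
  smooth_on D nu1 -> smooth_on D nu2 ->
  (forall u v, D (u, v) ->
     0 < nu1 u v - nu2 u v /\ gam1 u v <> 0 /\ gam2 u v <> 0) ->
  space_like_surface D z l -> principal_parameters D z l ->
  has_invariants D z l nu1 nu2 gam1 gam2 ->
  framed_surface D p q (fun u v => gam1 u v * p u v) (fun u v => nu1 u v * p u v)
    (fun u v => gam2 u v * q u v) (fun u v => nu2 u v * q u v)
    z (frameX z) (frameY z) l /\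
  forall u v, D (u, v) ->
    orthonormal (frameX z u v) (frameY z u v) (l u v) /\
    0 < det3 (frameX z u v) (frameY z u v) (l u v).
Proof.
  intros HO Hii Sn1 Sn2 Hreg Hsurf Hpr Hinv.
  pose proof (surface_speeds D nu1 nu2 gam1 gam2 p q z l HO Hii Sn1 Sn2 Hreg Hsurf
                Hpr Hinv) as Hspeed.
  destruct Hii as (Sp & Sq & Hint). destruct Hsurf as (Sz & _ & (Sl & Hl) & _).
  pose proof (vsmooth_vdu D z Sz) as Sa. pose proof (vsmooth_vdv D z Sz) as Sb.
  assert (HX : forall u v, D (u, v) -> frameX z u v = scal (/ p u v) (vdu z u v)).
  { intros u v HD. destruct (Hspeed u v HD) as (hE & _).
    destruct (Hint u v HD) as (hp & _). unfold frameX.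
    rewrite hE, sqrt_mul_self by assumption. reflexivity. }
  assert (HY : forall u v, D (u, v) -> frameY z u v = scal (/ q u v) (vdv z u v)).
  { intros u v HD. destruct (Hspeed u v HD) as (_ & hG & _).
    destruct (Hint u v HD) as (_ & hq & _). unfold frameY.
    rewrite hG, sqrt_mul_self by assumption. reflexivity. }
  assert (Hon : forall u v, D (u, v) ->
    orthonormal (frameX z u v) (frameY z u v) (l u v)).
  { intros u v HD. destruct (Hspeed u v HD) as (hE & hG & _).
    destruct (Hint u v HD) as (hp & hq & _).
    destruct (Hl u v HD) as (ll & la & lb & _). destruct (Hpr u v HD) as [hF _].
    unfold coefE, coefF, coefG in *.
    rewrite mink_sym in la, lb.
    rewrite HX, HY by exact HD. unfold orthonormal.
    rewrite !mink_scal_l, !mink_scal_r, hE, hG, hF, la, lb, ll.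
    split_ands; field; lra. }
  split; [|intros u v HD; split; [apply Hon, HD|apply Hl, HD]].
  split.
  2:{ intros u v HD. destruct (Hint u v HD) as (hp & hq & _).
      rewrite HX, HY, !scal_scal_inv by (exact HD || lra).
      split; [apply (vsmooth_is_vdu D)|apply (vsmooth_is_vdv D)]; assumption. }
  intros u v HD.
  destruct (Hint u v HD) as (hp & hq & _ & _ & hpv & hqu & _).
  destruct (Hspeed u v HD) as (hE & hG & hlu & hlv & _).
  destruct (Hl u v HD) as (ll & la & lb & _). destruct (Hpr u v HD) as [hF hM].
  destruct (Hinv u v HD) as (i1 & i2 & _ & _).
  assert (hL : coefL z l u v = nu1 u v * (p u v * p u v))
    by (rewrite <- i1; unfold inv_nu1; rewrite hE; field; lra).
  assert (hN : coefN z l u v = nu2 u v * (q u v * q u v))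
    by (rewrite <- i2; unfold inv_nu2; rewrite hG; field; lra).
  pose proof (smooth_is_du D p u v Sp HD) as dpu.
  pose proof (smooth_is_dv D p u v Sp HD) as dpv.
  pose proof (smooth_is_du D q u v Sq HD) as dqu.
  pose proof (smooth_is_dv D q u v Sq HD) as dqv.
  pose proof (vsmooth_mixed D z u v HO Sz HD) as Hmix.
  assert (Hsq : forall (f : R -> R) x f', is_derive f x f' ->
            is_derive (fun t => f t * f t) x (2 * f x * f')).
  { intros f x f' h. eapply is_derive_mul; [exact h|exact h|ring]. }
  pose proof (mink_du_eq D (vdu z) (vdu z) (fun x y => p x y * p x y) u v _ HO Sa Sa HD
    (fun x y h => proj1 (Hspeed x y h)) (Hsq _ _ _ dpu)) as Eu.
  pose proof (mink_dv_eq D (vdu z) (vdu z) (fun x y => p x y * p x y) u v _ HO Sa Sa HD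
    (fun x y h => proj1 (Hspeed x y h)) (Hsq _ _ _ dpv)) as Ev.
  pose proof (mink_du_eq D (vdv z) (vdv z) (fun x y => q x y * q x y) u v _ HO Sb Sb HD
    (fun x y h => proj1 (proj2 (Hspeed x y h))) (Hsq _ _ _ dqu)) as Gu.
  pose proof (mink_dv_eq D (vdv z) (vdv z) (fun x y => q x y * q x y) u v _ HO Sb Sb HD
    (fun x y h => proj1 (proj2 (Hspeed x y h))) (Hsq _ _ _ dqv)) as Gv.
  pose proof (mink_du_eq D (vdu z) (vdv z) (fun _ _ => 0) u v 0 HO Sa Sb HD
    (fun x y h => proj1 (Hpr x y h)) (is_derive_cst 0 u)) as Fu.
  pose proof (mink_dv_eq D (vdu z) (vdv z) (fun _ _ => 0) u v 0 HO Sa Sb HD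
    (fun x y h => proj1 (Hpr x y h)) (is_derive_cst 0 v)) as Fv.
  unfold coefE, coefF, coefG, coefL, coefM, coefN in *.
  rewrite Hmix in Gu, Fu. rewrite hpv in Ev. rewrite hqu in Gu.
  rewrite (mink_sym (vdu z u v) (vdu (vdu z) u v)) in Eu.
  rewrite (mink_sym (vdu z u v) (vdv (vdu z) u v)) in Ev, Fu.
  rewrite (mink_sym (vdv z u v) (vdv (vdu z) u v)) in Gu.
  rewrite (mink_sym (vdv z u v) (vdv (vdv z) u v)) in Gv.
  rewrite (mink_sym (vdu z u v) (vdv (vdv z) u v)) in Fv.
  rewrite mink_sym in la, lb, hL, hM, hN.
  (* The products of second derivatives of z with the frame. *)
  assert (a1 : mink (vdu (vdu z) u v) (vdu z u v) = p u v * du p u v) by lra.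
  assert (a2 : mink (vdv (vdu z) u v) (vdu z u v)
                 = p u v * (- (gam1 u v * p u v * q u v))) by lra.
  assert (a3 : mink (vdv (vdu z) u v) (vdv z u v)
                 = q u v * (gam2 u v * p u v * q u v)) by lra.
  assert (a4 : mink (vdv (vdv z) u v) (vdv z u v) = q u v * dv q u v) by lra.
  assert (a5 : mink (vdu (vdu z) u v) (vdv z u v)
                 = p u v * (gam1 u v * p u v * q u v)) by lra.
  assert (a6 : mink (vdv (vdv z) u v) (vdu z u v)
                 = - (q u v * (gam2 u v * p u v * q u v))) by lra.
  assert (hF' : mink (vdv z u v) (vdu z u v) = 0) by (rewrite mink_sym; exact hF).
  assert (la' : mink (l u v) (vdu z u v) = 0) by (rewrite mink_sym; exact la).
  assert (lb' : mink (l u v) (vdv z u v) = 0) by (rewrite mink_sym; exact lb).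
  assert (Hnd : det3 (frameX z u v) (frameY z u v) (l u v) <> 0)
    by (apply Rgt_not_eq, Hl, HD).
  assert (lX1 : locally u (fun x => scal (/ p x v) (vdu z x v) = frameX z x v)).
  { eapply filter_imp; [|apply (locally_open1 D u v HO HD)].
    intros x Hx; symmetry; apply HX, Hx. }
  assert (lX2 : locally v (fun y => scal (/ p u y) (vdu z u y) = frameX z u y)).
  { eapply filter_imp; [|apply (locally_open2 D u v HO HD)].
    intros y Hy; symmetry; apply HX, Hy. }
  assert (lY1 : locally u (fun x => scal (/ q x v) (vdv z x v) = frameY z x v)).
  { eapply filter_imp; [|apply (locally_open1 D u v HO HD)].
    intros x Hx; symmetry; apply HY, Hx. }
  assert (lY2 : locally v (fun y => scal (/ q u y) (vdv z u y) = frameY z u y)).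
  { eapply filter_imp; [|apply (locally_open2 D u v HO HD)].
    intros y Hy; symmetry; apply HY, Hy. }
  assert (hp0 : p u v <> 0) by lra. assert (hq0 : q u v <> 0) by lra.
  assert (Hcong : forall (w : R -> vec) x a b, vderiv w x a -> a = b -> vderiv w x b)
    by (intros w x a b h <-; exact h).
  (* Both sides of each frame equation have the same products with X, Y, l. *)
  assert (Hcmp : forall a b : vec,
    mink a (vdu z u v) = mink b (vdu z u v) ->
    mink a (vdv z u v) = mink b (vdv z u v) ->
    mink a (l u v) = mink b (l u v) -> a = b).
  { intros a b h1 h2 h3. apply (mink_nondegenerate _ _ _ _ _ Hnd);
      rewrite ?HX, ?HY, ?mink_scal_r by exact HD; congruence. }
  split; [|split; [|split; [|split; [|split]]]].
  - eapply Hcong; [eapply vderiv_ext_loc; [exact lX1|]; apply vderiv_scal;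
      [apply (is_derive_inv (fun x => p x v)); [exact dpu|exact hp0]
      |apply (vsmooth_is_vdu D (vdu z)); assumption]|].
    apply Hcmp; rewrite ?HX, ?HY, ?mink_plus_scal_l, ?mink_comb_l, ?mink_scal_l by exact HD;
      rewrite ?hE, ?hG, ?hF, ?hF', ?la, ?la', ?lb, ?lb', ?ll, ?hL, ?a1, ?a5;
      field; auto.
  - eapply Hcong; [eapply vderiv_ext_loc; [exact lY1|]; apply vderiv_scal;
      [apply (is_derive_inv (fun x => q x v)); [exact dqu|exact hq0]
      |apply (vsmooth_is_vdu D (vdv z)); assumption]|].
    rewrite Hmix, hqu.
    apply Hcmp; rewrite ?HX, ?HY, ?mink_plus_scal_l, ?mink_comb_l, ?mink_scal_l by exact HD;
      rewrite ?hE, ?hG, ?hF, ?hF', ?la, ?la', ?lb, ?lb', ?ll, ?hM, ?a2, ?a3;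
      field; auto.
  - eapply Hcong; [apply (vsmooth_is_vdu D l); assumption|]. rewrite hlu.
    apply Hcmp; rewrite ?HX, ?HY, ?mink_plus_scal_l, ?mink_comb_l, ?mink_scal_l by exact HD;
      rewrite ?hE, ?hG, ?hF, ?hF', ?la, ?la', ?lb, ?lb', ?ll;
      field; auto.
  - eapply Hcong; [eapply vderiv_ext_loc; [exact lX2|]; apply vderiv_scal;
      [apply (is_derive_inv (fun y => p u y)); [exact dpv|exact hp0]
      |apply (vsmooth_is_vdv D (vdu z)); assumption]|].
    rewrite hpv.
    apply Hcmp; rewrite ?HX, ?HY, ?mink_plus_scal_l, ?mink_comb_l, ?mink_scal_l by exact HD;
      rewrite ?hE, ?hG, ?hF, ?hF', ?la, ?la', ?lb, ?lb', ?ll, ?hM, ?a2, ?a3;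
      field; auto.
  - eapply Hcong; [eapply vderiv_ext_loc; [exact lY2|]; apply vderiv_scal;
      [apply (is_derive_inv (fun y => q u y)); [exact dqv|exact hq0]
      |apply (vsmooth_is_vdv D (vdv z)); assumption]|].
    apply Hcmp; rewrite ?HX, ?HY, ?mink_plus_scal_l, ?mink_comb_l, ?mink_scal_l by exact HD;
      rewrite ?hE, ?hG, ?hF, ?hF', ?la, ?la', ?lb, ?lb', ?ll, ?hN, ?a4, ?a6;
      field; auto.
  - eapply Hcong; [apply (vsmooth_is_vdv D l); assumption|]. rewrite hlv.
    apply Hcmp; rewrite ?HX, ?HY, ?mink_plus_scal_l, ?mink_comb_l, ?mink_scal_l by exact HD;
      rewrite ?hE, ?hG, ?hF, ?hF', ?la, ?la', ?lb, ?lb', ?ll;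
      field; auto.
Qed.

(** Two frames satisfying the same frame equations differ by a constant linear map:
    the products of the columns of the one with the columns of the other are
    constant. *)
Lemma frame_transport (D : R * R -> Prop) (a b c d : R -> R -> R)
  (X Y l X1 Y1 l1 : R -> R -> vec) (u0 v0 : R) :
  open D -> connected_set D -> D (u0, v0) ->
  frame_eqs D a b c d X Y l -> frame_eqs D a b c d X1 Y1 l1 ->
  (forall u v, D (u, v) -> orthonormal (X u v) (Y u v) (l u v)) ->
  forall u v, D (u, v) ->
    let T := frame_map (X u0 v0) (Y u0 v0) (l u0 v0)
               (X1 u0 v0) (Y1 u0 v0) (l1 u0 v0) in
    X1 u v = T (X u v) /\ Y1 u v = T (Y u v).
Proof.
  intros HO HC H0 HF HF1 Hon u v HD T.
  apply frame_eqs_coord in HF, HF1.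
  destruct HF as (F1 & F2 & F3). destruct HF1 as (G1 & G2 & G3).
  pose proof (orthonormal_transpose _ _ _ (Hon u v HD)) as Ht.
  assert (Hrow : forall cr : vec -> R,
    frame_eqs1 D a b c d (fun u v => cr (X1 u v)) (fun u v => cr (Y1 u v))
      (fun u v => cr (l1 u v)) ->
    let K := fun ci : vec -> R => cr (X1 u0 v0) * ci (X u0 v0)
               + cr (Y1 u0 v0) * ci (Y u0 v0) - cr (l1 u0 v0) * ci (l u0 v0) in
    cr (X1 u v) = K crd1 * crd1 (X u v) + K crd2 * crd2 (X u v)
                  - K crd3 * crd3 (X u v) /\
    cr (Y1 u v) = K crd1 * crd1 (Y u v) + K crd2 * crd2 (Y u v)
                  - K crd3 * crd3 (Y u v)).
  { intros cr G K.
    pose proof (frame_pairing_const D a b c d _ _ _ _ _ _ HO HC G F1 u v u0 v0 HD H0) as k1.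
    pose proof (frame_pairing_const D a b c d _ _ _ _ _ _ HO HC G F2 u v u0 v0 HD H0) as k2.
    pose proof (frame_pairing_const D a b c d _ _ _ _ _ _ HO HC G F3 u v u0 v0 HD H0) as k3.
    cbv beta in k1, k2, k3.
    change (cr (X1 u0 v0) * crd1 (X u0 v0) + cr (Y1 u0 v0) * crd1 (Y u0 v0)
            - cr (l1 u0 v0) * crd1 (l u0 v0)) with (K crd1) in k1.
    change (cr (X1 u0 v0) * crd2 (X u0 v0) + cr (Y1 u0 v0) * crd2 (Y u0 v0)
            - cr (l1 u0 v0) * crd2 (l u0 v0)) with (K crd2) in k2.
    change (cr (X1 u0 v0) * crd3 (X u0 v0) + cr (Y1 u0 v0) * crd3 (Y u0 v0)
            - cr (l1 u0 v0) * crd3 (l u0 v0)) with (K crd3) in k3.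
    (* Expansion of one column of the second frame in the columns of the first. *)
    pose proof (orthonormal_expansion _ _ _
      (cr (X1 u v), cr (Y1 u v), cr (l1 u v)) Ht) as E.
    rewrite <- k1, <- k2, <- k3.
    pose proof (f_equal crd1 E) as E1. pose proof (f_equal crd2 E) as E2.
    unfold mink, comb in E1, E2. cbn [crd1 crd2 crd3 fst snd] in E1, E2.
    unfold crd1 at 1, crd2 at 1 in E1. unfold crd2 at 1 in E2. simpl in E1, E2.
    unfold crd1, crd2, crd3 in *; simpl in *.
    split; [rewrite E1 at 1|rewrite E2 at 1]; ring. }
  destruct (Hrow crd1 G1) as [x1 y1]. destruct (Hrow crd2 G2) as [x2 y2].
  destruct (Hrow crd3 G3) as [x3 y3].
  split; apply vec_eq.
  - rewrite x1. unfold T, frame_map, comb, mink, crd1, crd2, crd3; simpl; ring.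
  - rewrite x2. unfold T, frame_map, comb, mink, crd1, crd2, crd3; simpl; ring.
  - rewrite x3. unfold T, frame_map, comb, mink, crd1, crd2, crd3; simpl; ring.
  - rewrite y1. unfold T, frame_map, comb, mink, crd1, crd2, crd3; simpl; ring.
  - rewrite y2. unfold T, frame_map, comb, mink, crd1, crd2, crd3; simpl; ring.
  - rewrite y3. unfold T, frame_map, comb, mink, crd1, crd2, crd3; simpl; ring.
Qed.

Lemma vderiv_frame_map (X Y l X1 Y1 l1 : vec) (w : R -> vec) (x : R) (w' : vec) :
  vderiv w x w' ->
  vderiv (fun t => frame_map X Y l X1 Y1 l1 (w t)) x (frame_map X Y l X1 Y1 l1 w').
Proof.
  intros Hw.
  assert (Hc : forall V : vec, is_derive (fun t => mink (w t) V) x (mink w' V)).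
  { intros V. destruct Hw as (h1 & h2 & h3). unfold mink.
    eapply is_derive_sub; [eapply is_derive_add|..];
      try (eapply is_derive_mul; [eassumption|apply is_derive_cst|reflexivity]);
      [reflexivity|ring]. }
  assert (H : forall k1 k2 k3, is_derive (fun t => mink (w t) X * k1
            + mink (w t) Y * k2 + - mink (w t) l * k3) x
            (mink w' X * k1 + mink w' Y * k2 + - mink w' l * k3)).
  { intros k1 k2 k3.
    assert (Hm : forall (f : R -> R) f' k, is_derive f x f' ->
              is_derive (fun t => f t * k) x (f' * k)).
    { intros f f' k h. eapply is_derive_mul; [exact h|apply is_derive_cst|ring]. }
    apply (is_derive_add (fun t => mink (w t) X * k1 + mink (w t) Y * k2)
             (fun t => - mink (w t) l * k3) x
             (mink w' X * k1 + mink w' Y * k2) (- mink w' l * k3)); [| |reflexivity].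
    - apply (is_derive_add (fun t => mink (w t) X * k1) (fun t => mink (w t) Y * k2) x
               (mink w' X * k1) (mink w' Y * k2)); [| |reflexivity]; apply Hm, Hc.
    - apply (Hm (fun t => - mink (w t) l) (- mink w' l)).
      apply (is_derive_opp (fun t => mink (w t) l)), Hc. }
  split_ands; apply H.
Qed.

Lemma frame_map_scal (X Y l X1 Y1 l1 : vec) (k : R) (w : vec) :
  frame_map X Y l X1 Y1 l1 (scal k w) = scal k (frame_map X Y l X1 Y1 l1 w).
Proof. apply (linear_scal _ (frame_map_linear X Y l X1 Y1 l1) k w). Qed.

(** Two framed surfaces with the same coefficients differ by the motion sending one
    initial frame to the other. *)
Lemma framed_surface_unique (D : R * R -> Prop) (p q a b c d : R -> R -> R)
  (z X Y l z1 X1 Y1 l1 : R -> R -> vec) (u0 v0 : R) :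
  open D -> connected_set D -> D (u0, v0) ->
  framed_surface D p q a b c d z X Y l ->
  framed_surface D p q a b c d z1 X1 Y1 l1 ->
  (forall u v, D (u, v) -> orthonormal (X u v) (Y u v) (l u v)) ->
  forall u v, D (u, v) ->
    let T := frame_map (X u0 v0) (Y u0 v0) (l u0 v0)
               (X1 u0 v0) (Y1 u0 v0) (l1 u0 v0) in
    z1 u v = plus (T (z u v)) (minus (z1 u0 v0) (T (z u0 v0))).
Proof.
  intros HO HC H0 [HF Hz] [HF1 Hz1] Hon u v HD T.
  assert (Hu : forall x y, D (x, y) ->
    vderiv (fun t => T (z t y)) x (scal (p x y) (X1 x y)) /\
    vderiv (fun t => T (z x t)) y (scal (q x y) (Y1 x y))).
  { intros x y Hxy.
    destruct (frame_transport D a b c d X Y l X1 Y1 l1 u0 v0 HO HC H0 HF HF1 Hon x y Hxy)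
      as [-> ->].
    unfold T. rewrite <- !frame_map_scal.
    destruct (Hz x y Hxy) as [h1 h2].
    split; apply vderiv_frame_map; [exact h1|exact h2]. }
  assert (E : forall cr : vec -> R,
    (forall w x w', vderiv w x w' -> is_derive (fun t => cr (w t)) x (cr w')) ->
    cr (z1 u v) = cr (T (z u v)) + (cr (z1 u0 v0) - cr (T (z u0 v0)))).
  { intros cr Hcr.
    pose proof (const_on_connected D (fun x y => cr (z1 x y) - cr (T (z x y))) HO HC) as h.
    cbv beta in h. rewrite <- (h) with (u := u) (v := v); try assumption; [ring|].
    intros x y Hxy. destruct (Hu x y Hxy) as [t1 t2]. destruct (Hz1 x y Hxy) as [s1 s2].
    split; (eapply is_derive_sub; [apply Hcr; eassumption|apply Hcr; eassumption|ring]). }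
  apply vec_eq; [apply (E crd1)|apply (E crd2)|apply (E crd3)];
    intros w x w' (h1 & h2 & h3); assumption.
Qed.

Theorem theorem2p1
  (D : R * R -> Prop) (u0 v0 : R) (nu1 nu2 gam1 gam2 : R -> R -> R)
  (z0 X0 Y0 l0 : vec)
  (D_open : open D) (D_u0v0 : D (u0, v0))
  (nu1_smooth : smooth_on D nu1) (nu2_smooth : smooth_on D nu2)
  (gam1_smooth : smooth_on D gam1) (gam2_smooth : smooth_on D gam2)
  (nu_pos : forall u v : R, D (u, v) -> 0 < nu1 u v - nu2 u v)
  (cond1 : forall u v : R, D (u, v) ->
     0 < gam1 u v * dv nu1 u v /\ 0 < gam2 u v * du nu2 u v)
  (cond21 : forall u v : R, D (u, v) ->
     du (fun s t => ln (dv nu1 s t / gam1 s t)) u v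
       = du nu1 u v / (nu1 u v - nu2 u v) /\
     dv (fun s t => ln (du nu2 s t / gam2 s t)) u v
       = - (dv nu2 u v / (nu1 u v - nu2 u v)))
  (cond22 : forall u v : R, D (u, v) ->
     (nu1 u v - nu2 u v) / 2 *
       (du (fun s t => gam2 s t ^ 2) u v / du nu2 u v
        - dv (fun s t => gam1 s t ^ 2) u v / dv nu1 u v)
     + gam1 u v ^ 2 + gam2 u v ^ 2 = nu1 u v * nu2 u v)
  (frame0 : positive_orthonormal_frame X0 Y0 l0) :
  exists D0 : R * R -> Prop,
    open D0 /\ connected_set D0 /\ D0 (u0, v0) /\ (forall p, D0 p -> D p) /\
    exists z l : R -> R -> vec,
      (space_like_surface D0 z l /\ strongly_regular D0 z l /\
       has_invariants D0 z l nu1 nu2 gam1 gam2 /\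
       initial_frame z l u0 v0 z0 X0 Y0 l0 /\
       principal_parameters D0 z l) /\
      (forall (D1 : R * R -> Prop) (z1 l1 : R -> R -> vec),
         open D1 -> connected_set D1 -> D1 (u0, v0) -> (forall p, D1 p -> D0 p) ->
         space_like_surface D1 z1 l1 -> strongly_regular D1 z1 l1 ->
         principal_parameters D1 z1 l1 ->
         has_invariants D1 z1 l1 nu1 nu2 gam1 gam2 ->
         (exists T : vec -> vec, is_motion T /\
            forall u v : R, D1 (u, v) -> z1 u v = T (z u v)) /\
         (initial_frame z1 l1 u0 v0 z0 X0 Y0 l0 ->
            forall u v : R, D1 (u, v) -> z1 u v = z u v)).
Proof.
  pose proof (invariants_integrable D nu1 nu2 gam1 gam2 D_open nu1_smooth nu2_smooth
    gam1_smooth gam2_smooth nu_pos cond1 cond21 cond22) as Hii.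
  set (p := fun u v => du nu2 u v / gam2 u v / (nu1 u v - nu2 u v)) in Hii.
  set (q := fun u v => dv nu1 u v / gam1 u v / (nu1 u v - nu2 u v)) in Hii.
  clearbody p q.
  assert (Hii_sub : forall D1 : R * R -> Prop, (forall w, D1 w -> D w) ->
            integrable_invariants D1 p q nu1 nu2 gam1 gam2).
  { intros D1 H. destruct Hii as (h1 & h2 & h3).
    split; [|split]; try (eapply smooth_sub; eassumption).
    intros u v HD; apply h3, H, HD. }
  assert (Hreg : forall u v, D (u, v) ->
            0 < nu1 u v - nu2 u v /\ gam1 u v <> 0 /\ gam2 u v <> 0).
  { intros u v HD. destruct (cond1 u v HD). split; [apply nu_pos, HD|].
    split; intros E; rewrite E in *; lra. }
  pose proof Hii as (Sp & Sq & Hint).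
  pose (a := fun u v => gam1 u v * p u v). pose (b := fun u v => nu1 u v * p u v).
  pose (c := fun u v => gam2 u v * q u v). pose (d := fun u v => nu2 u v * q u v).
  destruct (framed_surface_exists D u0 v0 p q a b c d) as (r & Hr & HsD & Hex);
    try (apply smooth_mult); try assumption.
  { intros u v HD. destruct (Hint u v HD) as (_ & _ & c1 & c2 & c3 & c4 & c5).
    assert (da : dv a u v = dv gam1 u v * p u v + gam1 u v * dv p u v).
    { apply is_derive_unique. eapply is_derive_mul;
        [apply (smooth_is_dv D gam1)|apply (smooth_is_dv D p)|reflexivity]; assumption. }
    assert (db : dv b u v = dv nu1 u v * p u v + nu1 u v * dv p u v).
    { apply is_derive_unique. eapply is_derive_mul;
        [apply (smooth_is_dv D nu1)|apply (smooth_is_dv D p)|reflexivity]; assumption. }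
    assert (dc : du c u v = du gam2 u v * q u v + gam2 u v * du q u v).
    { apply is_derive_unique. eapply is_derive_mul;
        [apply (smooth_is_du D gam2)|apply (smooth_is_du D q)|reflexivity]; assumption. }
    assert (dd : du d u v = du nu2 u v * q u v + nu2 u v * du q u v).
    { apply is_derive_unique. eapply is_derive_mul;
        [apply (smooth_is_du D nu2)|apply (smooth_is_du D q)|reflexivity]; assumption. }
    rewrite da, db, dc, dd, <- c5, c1, c2, c3, c4. unfold a, b, c, d.
    split_ands; ring. }
  destruct (Hex z0 X0 Y0 l0) as
    (z & X & Y & l & Iz & IX & IY & Il & Sz & SX & SY & Sl & Hfr).
  apply positive_frame_orthonormal in frame0. destruct frame0 as [on0 det0].
  set (D0 := square u0 v0 r) in *.
  assert (D0_open : open D0) by apply square_open.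
  assert (D0_conn : connected_set D0) by apply square_connected.
  assert (D0_0 : D0 (u0, v0)) by (apply square_center, Hr).
  assert (Hon : forall u v, D0 (u, v) -> orthonormal (X u v) (Y u v) (l u v) /\
            0 < det3 (X u v) (Y u v) (l u v)).
  { intros u v HD. destruct Hfr as [HF _]. split.
    - apply (frame_orthonormal D0 a b c d X Y l u0 v0); try assumption.
      rewrite IX, IY, Il; exact on0.
    - rewrite (frame_det3 D0 a b c d X Y l D0_open D0_conn HF u v u0 v0 HD D0_0).
      rewrite IX, IY, Il; exact det0. }
  destruct (framed_surface_geometry D0 p q nu1 nu2 gam1 gam2 z X Y l D0_open
    (Hii_sub D0 HsD) (fun u v h => Hreg u v (HsD _ h)) Sz Sl Hfr Hon)
    as ((Hsurf & Hsr & Hinv & Hpr) & HXY).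
  exists D0. split; [exact D0_open|]. split; [exact D0_conn|].
  split; [exact D0_0|]. split; [exact HsD|].
  exists z, l. split.
  { split; [exact Hsurf|]. split; [exact Hsr|]. split; [exact Hinv|].
    split; [|exact Hpr]. destruct (HXY u0 v0 D0_0) as [hX hY].
    split; [exact Iz|]. rewrite hX, hY. auto. }
  intros D1 z1 l1 D1_open D1_conn D1_0 D1_sub Hsurf1 _ Hpr1 Hinv1.
  assert (D1_D : forall w, D1 w -> D w) by auto.
  destruct (surface_framed D1 nu1 nu2 gam1 gam2 p q z1 l1 D1_open (Hii_sub D1 D1_D)
    (smooth_sub D D1 nu1 D1_D nu1_smooth) (smooth_sub D D1 nu2 D1_D nu2_smooth)
    (fun u v h => Hreg u v (D1_D _ h)) Hsurf1 Hpr1 Hinv1) as [Hfr1 Hon1].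
  assert (Hfr' : framed_surface D1 p q a b c d z X Y l).
  { destruct Hfr as [h1 h2].
    split; intros u v h; [apply h1|apply h2]; apply D1_sub, h. }
  pose proof (framed_surface_unique D1 p q a b c d z X Y l z1 (frameX z1) (frameY z1) l1
    u0 v0 D1_open D1_conn D1_0 Hfr' Hfr1
    (fun u v h => proj1 (Hon u v (D1_sub _ h)))) as Huniq.
  cbv zeta in Huniq. rewrite IX, IY, Il, Iz in Huniq.
  destruct (Hon1 u0 v0 D1_0) as [on1 det1].
  set (A := frame_map X0 Y0 l0 (frameX z1 u0 v0) (frameY z1 u0 v0) (l1 u0 v0)) in *.
  split.
  - exists (fun w => plus (A w) (minus (z1 u0 v0) (A z0))). split; [|exact Huniq].
    exists A, (minus (z1 u0 v0) (A z0)).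
    split; [apply frame_map_linear|].
    split; [intros; apply frame_map_mink; assumption|].
    split; [intros; apply frame_map_det3; assumption|]. reflexivity.
  - intros (Jz & JX & JY & Jl) u v HD.
    rewrite (Huniq u v HD).
    assert (HA : forall w, A w = w).
    { intros w. unfold A. rewrite JX, JY, Jl. unfold frame_map.
      symmetry; apply orthonormal_expansion, on0. }
    rewrite !HA, Jz. apply vec_eq; destruct (z u v) as [[s1 s2] s3];
      destruct z0 as [[t1 t2] t3]; unfold minus, plus, opp, crd1, crd2, crd3; simpl;
      unfold plus, opp; simpl; ring.
Qed.
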